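(* Let $M$ be a connected, complete Riemannian manifold of dimension $n\ge 2$ with constant sectional curvature $K\neq 0$. Let $U\subset M$ be a nonempty open subset, and let $f:U\to\mathbb{C}$ be a smooth eigenfunction of the Laplace-Beltrami operator, i.e. $\Delta f=-\lambda f$ on $U$ for some $\lambda\in\mathbb{C}$. Let $\Pi(\mathrm{Ten}(TM^{\mathbb{C}}))$ be the space of all parallel tensors on $M$, acting on $C^\infty(U)_{\mathbb{C}}$ by covariant derivatives. Then, as a vector space, $$\Pi(\mathrm{Ten}(TM^{\mathbb{C}}))\,f=\mathbb{C}f ,$$ i.e. the span of the covariant derivatives of $f$ along all parallel tensors is $\mathbb{C}f$.
   Context: $TM^{\mathbb{C}}=\mathbb{C}\otimes_{\mathbb{R}}TM$ is the complexified tangent bundle with the connection induced by the Levi-Civita connection $\nabla$; $\mathrm{Ten}(TM^{\mathbb{C}})=\bigoplus_{r\ge 0}(TM^{\mathbb{C}})^{\otimes r}$ is the tensor algebra bundle with the induced connection. $\Pi((TM^{\mathbb{C}})^{\otimes r})$ is the space of (global) parallel sections of $(TM^{\mathbb{C}})^{\otimes r}$, and $\Pi(\mathrm{Ten}(TM^{\mathbb{C}}))=\bigoplus_{r\ge0}\Pi((TM^{\mathbb{C}})^{\otimes r})$ (the degree $0$ part consists of the constants $\mathbb{C}$). $C^\infty(U)_{\mathbb{C}}$ is the space of smooth complex-valued functions on $U$. For smooth $f$ on $U$, the iterated covariant derivatives are defined by $\nabla^1 f=df$ and $(\nabla^m f)(Z_1,\dots,Z_m)=(\nabla_{Z_1}(\nabla^{m-1}f))(Z_2,\dots,Z_m)$,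 extended complex-linearly to sections of $(TM^{\mathbb{C}})^{\otimes m}$. A parallel tensor $X\in\Pi((TM^{\mathbb{C}})^{\otimes m})$ acts on $f$ by $Xf=(\nabla^m f)(X)$ (degree $0$: scalar multiplication), and the action is extended linearly. $\Delta f$ is the trace of $\nabla^2 f$, i.e. $\Delta f=\sum_{i=1}^n(\nabla^2f)(X_i,X_i)$ for any local orthonormal frame $X_1,\dots,X_n$. *)

(* Defs.v *)
From HB Require Import structures.
From mathcomp Require Import all_boot all_order all_algebra.
From mathcomp Require Import all_classical all_reals all_analysis.
From mathcomp Require Import complex.

Set Implicit Arguments.
Unset Strict Implicit.
Unset Printing Implicit Defensive.

Import Order.TTheory GRing.Theory Num.Theory.
Import numFieldNormedType.Exports.

Local Open Scope classical_set_scope.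
Local Open Scope ring_scope.
Local Open Scope complex_scope.

(* A tangent vector at a point of a chart is the row vector of its components
   in the coordinate frame d/dx^0, ..., d/dx^(n-1).  Tensor fields are given by
   their components in every chart of the atlas, subject to the transformation
   law; components are functions of the coordinates x : 'rV[R]_n, and only their
   values on the (open) image of the chart are meaningful. *)

Section Calculus.
Context {R : realType} {n : nat}.

Definition partial (i : 'I_n) (u : 'rV[R]_n -> R) : 'rV[R]_n -> R :=
  fun x => 'D_(delta_mx 0 i) u x.

Definition iter_partial (s : seq 'I_n) (u : 'rV[R]_n -> R) : 'rV[R]_n -> R :=
  foldr partial u s.

(* [O] is meant to be open: all iterated partial derivatives exist and are
   continuous at the points of [O]. *)
Definition smooth_on (O : set 'rV[R]_n) (u : 'rV[R]_n -> R) : Prop :=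
  forall (s : seq 'I_n) (x : 'rV[R]_n), O x ->
    {for x, continuous (iter_partial s u)} /\
    forall i : 'I_n, derivable (iter_partial s u) x (delta_mx 0 i).

Definition cpartial (i : 'I_n) (u : 'rV[R]_n -> R[i]) : 'rV[R]_n -> R[i] :=
  fun x => partial i (fun y => complex.Re (u y)) x
           +i* partial i (fun y => complex.Im (u y)) x.

Definition csmooth_on (O : set 'rV[R]_n) (u : 'rV[R]_n -> R[i]) : Prop :=
  smooth_on O (fun x => complex.Re (u x)) /\
  smooth_on O (fun x => complex.Im (u x)).

End Calculus.

(* [cmap] and [cinv] are mutually inverse homeomorphisms between the open sets
   [cdom] and [cimg]; their values elsewhere are irrelevant. *)
Record chart (R : realType) (n : nat) (T : topologicalType) := Chart {
  cdom : set T;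
  cimg : set 'rV[R]_n;
  cmap : T -> 'rV[R]_n;
  cinv : 'rV[R]_n -> T;
  cdom_open : open cdom;
  cimg_open : open cimg;
  cmap_cimg : forall p, cdom p -> cimg (cmap p);
  cinv_cdom : forall x, cimg x -> cdom (cinv x);
  cmapK : forall p, cdom p -> cinv (cmap p) = p;
  cinvK : forall x, cimg x -> cmap (cinv x) = x;
  cmap_continuous : forall p, cdom p -> {for p, continuous cmap};
  cinv_continuous : forall x, cimg x -> {for x, continuous cinv} }.

Definition transition (R : realType) (n : nat) (T : topologicalType)
    (c d : chart R n T) (x : 'rV[R]_n) : 'rV[R]_n :=
  cmap d (cinv c x).

Definition overlap (R : realType) (n : nat) (T : topologicalType)
    (c d : chart R n T) : set 'rV[R]_n :=
  [set x | cimg c x /\ cdom d (cinv c x)].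

(* Entry (i, a) is dy^a/dx^i, where x are the coordinates of c and y those of
   d; the components of a tangent vector transform by v |-> v *m J. *)
Definition transition_jac (R : realType) (n : nat) (T : topologicalType)
    (c d : chart R n T) (x : 'rV[R]_n) : 'M[R]_n :=
  \matrix_(i < n, a < n) partial i (fun y => transition c d y 0 a) x.

(* [metric c x] is the Gram matrix of the coordinate frame of the chart c. *)
Record riemannian_manifold (R : realType) (n : nat) := RiemannianManifold {
  carrier :> topologicalType;
  carrier_hausdorff : hausdorff_space carrier;
  carrier_second_countable : @second_countable carrier;
  atlas : Type;
  chart_of : atlas -> chart R n carrier;
  atlas_cover : forall p : carrier, exists c : atlas, cdom (chart_of c) p;
  atlas_smooth : forall (c d : atlas) (a : 'I_n),
    smooth_on (overlap (chart_of c) (chart_of d))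
      (fun x => transition (chart_of c) (chart_of d) x 0 a);
  metric : atlas -> 'rV[R]_n -> 'M[R]_n;
  metric_smooth : forall (c : atlas) (i j : 'I_n),
    smooth_on (cimg (chart_of c)) (fun x => metric c x i j);
  metric_sym : forall (c : atlas) (x : 'rV[R]_n), cimg (chart_of c) x ->
    (metric c x)^T = metric c x;
  metric_posdef : forall (c : atlas) (x : 'rV[R]_n), cimg (chart_of c) x ->
    forall v : 'rV[R]_n, v != 0 -> 0 < (v *m metric c x *m v^T) 0 0;
  metric_transition : forall (c d : atlas) (x : 'rV[R]_n),
    overlap (chart_of c) (chart_of d) x ->
    metric c x =
      transition_jac (chart_of c) (chart_of d) x
      *m metric d (transition (chart_of c) (chart_of d) x)
      *m (transition_jac (chart_of c) (chart_of d) x)^T }.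

Section Geometry.
Context {R : realType} {n : nat} (M : riemannian_manifold R n).
Implicit Types (c d : atlas M) (x y u v w : 'rV[R]_n).

Definition img c : set 'rV[R]_n := cimg (chart_of c).

Definition point c x : M := cinv (chart_of c) x.

Definition coord c (p : M) : 'rV[R]_n := cmap (chart_of c) p.

Definition inner c x u v : R := (u *m metric c x *m v^T) 0 0.

(* Levi-Civita connection: nabla_(d_i) d_j = \sum_k christoffel c x k i j d_k *)
Definition christoffel c x (k i j : 'I_n) : R :=
  2^-1 * \sum_(l < n) invmx (metric c x) k l *
    (partial i (fun y => metric c y j l) x
     + partial j (fun y => metric c y i l) x
     - partial l (fun y => metric c y i j) x).

(* R(d_i, d_j) d_k = \sum_l riemann c x l k i j d_l, where
   R(X, Y) Z = nabla_X nabla_Y Z - nabla_Y nabla_X Z - nabla_[X, Y] Z *)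
Definition riemann c x (l k i j : 'I_n) : R :=
  partial i (fun y => christoffel c y l j k) x
  - partial j (fun y => christoffel c y l i k) x
  + \sum_(m < n) (christoffel c x l i m * christoffel c x m j k
                  - christoffel c x l j m * christoffel c x m i k).

Definition curvature c x u v w : 'rV[R]_n :=
  \row_l \sum_(i < n) \sum_(j < n) \sum_(k < n)
    u 0 i * v 0 j * w 0 k * riemann c x l k i j.

Definition sectional c x u v : R :=
  inner c x (curvature c x u v v) u
  / (inner c x u u * inner c x v v - inner c x u v ^+ 2).

Definition constant_sectional_curvature (K : R) : Prop :=
  forall c x u v, img c x -> row_free (col_mx u v) -> sectional c x u v = K.

(* A geodesic is a continuous curve satisfying the geodesic equation at every
   time, in every chart through which it passes. *)
Definition geodesic (gam : R -> M) : Prop :=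
  continuous gam /\
  forall c (t : R), cdom (chart_of c) (gam t) ->
    let z := fun (k : 'I_n) (s : R) => coord c (gam s) 0 k in
    forall k : 'I_n,
    [/\ derivable (z k) t 1, derivable (derive1 (z k)) t 1 &
        derive1 (derive1 (z k)) t
        + \sum_(i < n) \sum_(j < n) christoffel c (coord c (gam t)) k i j
            * derive1 (z i) t * derive1 (z j) t = 0].

Definition geodesically_complete : Prop :=
  forall c x v, img c x ->
  exists gam : R -> M, [/\ geodesic gam, gam 0 = point c x &
    forall k : 'I_n, derive1 (fun s => coord c (gam s) 0 k) 0 = v 0 k].

Definition replace_at (r : nat) (I : r.-tuple 'I_n) (s : 'I_r) (l : 'I_n) :
    r.-tuple 'I_n :=
  [tuple if t == s then l else tnth I t | t < r].

(* Component [I] of nabla_(d_i) X, for X a section of (TM^C)^(\otimes r). *)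
Definition nabla_contra c (r : nat) (X : 'rV[R]_n -> r.-tuple 'I_n -> R[i])
    (i : 'I_n) x (I : r.-tuple 'I_n) : R[i] :=
  cpartial i (fun y => X y I) x
  + \sum_(s < r) \sum_(l < n)
      (christoffel c x (tnth I s) i l)%:C * X x (replace_at I s l).

(* Component [I] of nabla_(d_i) om, for om a covariant m-tensor field. *)
Definition nabla_cov c (m : nat) (om : 'rV[R]_n -> m.-tuple 'I_n -> R[i])
    (i : 'I_n) x (I : m.-tuple 'I_n) : R[i] :=
  cpartial i (fun y => om y I) x
  - \sum_(s < m) \sum_(l < n)
      (christoffel c x l i (tnth I s))%:C * om x (replace_at I s l).

Record parallel_tensor (r : nat) := ParallelTensor {
  comp :> atlas M -> 'rV[R]_n -> r.-tuple 'I_n -> R[i];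
  comp_smooth : forall c (I : r.-tuple 'I_n),
    csmooth_on (img c) (fun x => comp c x I);
  comp_transition : forall c d x (A : r.-tuple 'I_n),
    overlap (chart_of c) (chart_of d) x ->
    comp d (transition (chart_of c) (chart_of d) x) A =
      \sum_(I : r.-tuple 'I_n)
        (\prod_(s < r) transition_jac (chart_of c) (chart_of d) x
                         (tnth I s) (tnth A s))%:C * comp c x I;
  comp_parallel : forall c x (i : 'I_n) (I : r.-tuple 'I_n), img c x ->
    nabla_contra c (comp c) i x I = 0 }.

(* Elements of the direct sum over r of the parallel tensors of degree r:
   families of homogeneous components of degrees r < N, for some N. *)
Definition parallel_ten : Type :=
  {N : nat & forall r : 'I_N, parallel_tensor r}.

Definition smooth_fun (U : set M) (f : M -> R[i]) : Prop :=
  forall c, csmooth_on [set x | img c x /\ U (point c x)]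
                       (fun x => f (point c x)).

(* Components in the chart c of nabla^m f; the first index is that of the last
   derivative taken. *)
Fixpoint nabla_iter c (f : M -> R[i]) (m : nat) :
    'rV[R]_n -> m.-tuple 'I_n -> R[i] :=
  match m with
  | 0 => fun x _ => f (point c x)
  | m'.+1 => fun x I =>
      nabla_cov c (@nabla_iter c f m') (thead I) x (behead_tuple I)
  end.

Definition hessian c (f : M -> R[i]) x u v : R[i] :=
  \sum_(i < n) \sum_(j < n)
    (u 0 i * v 0 j)%:C * nabla_iter c f x [tuple i; j].

(* The rows of [E] form an orthonormal basis of the tangent space. *)
Definition orthonormal_basis c x (E : 'M[R]_n) : Prop :=
  forall a b : 'I_n, inner c x (row a E) (row b E) = (a == b)%:R.

(* Delta f = h on U *)
Definition laplacian_eq (U : set M) (f h : M -> R[i]) : Prop :=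
  forall c x (E : 'M[R]_n), img c x -> U (point c x) ->
    orthonormal_basis c x E ->
    \sum_(a < n) hessian c f x (row a E) (row a E) = h (point c x).

(* A chart around p; the value at p of (nabla^m f)(X) does not depend on it. *)
Definition chart_at (p : M) : atlas M := projT1 (cid (atlas_cover p)).

Definition act_hom (r : nat) (X : parallel_tensor r) (f : M -> R[i]) (p : M) :
    R[i] :=
  let c := chart_at p in let x := coord c p in
  \sum_(I : r.-tuple 'I_n) X c x I * nabla_iter c f x I.

Definition act (X : parallel_ten) (f : M -> R[i]) (p : M) : R[i] :=
  \sum_(r < projT1 X) act_hom (projT2 X r) f p.

End Geometry.

(* Main.v *)
Require Import Defs.
From HB Require Import structures.
From mathcomp Require Import all_boot all_order all_algebra fingroup perm.
From mathcomp Require Import all_classical all_reals all_analysis.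
From mathcomp Require Import complex.
From mathcomp Require Import ring lra.

Import Order.TTheory GRing.Theory Num.Theory.
Import numFieldNormedType.Exports.

Local Open Scope classical_set_scope.
Local Open Scope ring_scope.

(* Curvature K <> 0 makes every parallel tensor X invariant under so(n): the
   Ricci identity gives R(u, v) X = 0 and R(u, v) = K (u /\ v).  Contracting the
   invariance of X of degree r + 2 in its first slot gives
     (n - 1) X = \sum_s (g^-1 (x) C_(0,s) X - tau_(0,s) X),
   where s runs over the other slots, g^-1 (x) C_(0,s) X is the contraction of X
   over the slots 0 and s with g^-1 put back there, and tau_(0,s) permutes slots.
   By the Ricci identity again, permuting the arguments of \nabla^(r+2) f changes
   it by terms g (x) \nabla^r f, up to permutations, whose pairing with a parallel
   tensor is that of a parallel tensor of degree r with \nabla^r f.  Hence, up to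
   multiples of f provided by induction,
     (n - 1) X f = \sum_s (Delta ((C_(0,s) X) f) - X f),
   so (n + r) X f is a multiple of f.  The multiples are global constants because
   they all come from parallel tensors of degree 0, constant since M is
   connected.  Full invariant theory for SO(n) is never needed. *)

Set Implicit Arguments.
Unset Strict Implicit.
Unset Printing Implicit Defensive.

(** * Smooth functions and partial derivatives *)

(** The Ricci identity is used in two opposite ways. On a parallel tensor both second derivatives
    vanish, so it becomes an algebraic constraint, from which the factor K can be cancelled because
    K is nonzero. On the iterated derivatives of f it measures the failure of symmetry. Both uses
    need every component of the curvature, while the hypothesis controls only sectional curvature; a
    polarization argument bridges the gap. The Laplacian appears for this reason: if Y is parallel
    of degree m and its pairing with the m-th derivative of f is k f on U, then g^-1 (x) Y, with
    g^-1 in the two outermost slots, gives the Laplacian of k f. Hence g^-1 must be moved from slots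
    0 and s to slots 0 and 1, and this reordering is what creates lower order terms. The constant n
    + r is (n - 1) + (r + 1): each of the r + 1 slots other than slot 0 contributes one copy of X f.
    Contraction lowers the degree by two, so degrees 0 and 1 both start the induction; in degree 1
    there is no other slot and n >= 2 forces X = 0. *)

Section PartialDerivatives.
Context {R : realType} {n : nat}.
Implicit Types (O : set 'rV[R]_n) (u v : 'rV[R]_n -> R) (x : 'rV[R]_n).

Lemma smooth_on_continuous O u x : smooth_on O u -> O x -> {for x, continuous u}.
Proof. by move=> su Ox; have [] := su [::] x Ox. Qed.

Lemma smooth_on_derivable O u x i :
  smooth_on O u -> O x -> derivable u x (delta_mx 0 i).
Proof. by move=> su Ox; have [_ /(_ i)] := su [::] x Ox. Qed.

Lemma smooth_on_partial O u i : smooth_on O u -> smooth_on O (partial i u).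
Proof.
move=> su s x Ox.
by have := su (rcons s i) x Ox; rewrite /iter_partial foldr_rcons.
Qed.

Lemma smooth_on_sub O O' u : O' `<=` O -> smooth_on O u -> smooth_on O' u.
Proof. by move=> OO su s x /OO; apply: su. Qed.

Lemma near_open_eq (O : set 'rV[R]_n) (T : Type) (u v : 'rV[R]_n -> T) x :
  open O -> O x -> (forall y, O y -> u y = v y) -> \near x, u x = v x.
Proof.
move=> oO Ox uv; near=> y; apply: uv; near: y; exact: open_nbhs_nbhs.
Unshelve. all: by end_near. Qed.

Lemma continuous_ext_on O u v x : open O -> O x ->
  (forall y, O y -> u y = v y) -> {for x, continuous v} -> {for x, continuous u}.
Proof.
move=> oO Ox uv; rewrite /prop_for /continuous_at (uv x Ox) => cv.
have vu y : O y -> v y = u y by move/uv.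
exact: (cvg_trans (near_eq_cvg (near_open_eq oO Ox vu)) cv).
Qed.

Lemma partial_ext O u v i x : open O -> O x -> (forall y, O y -> u y = v y) ->
  partial i u x = partial i v x.
Proof.
by move=> oO Ox uv; apply: near_eq_derive; apply: (near_open_eq oO Ox).
Qed.

(* Smoothness by coinduction: a class of functions that is stable under partial
   derivatives up to equality on [O] consists of smooth functions. *)
Lemma smooth_on_coind O (P : ('rV[R]_n -> R) -> Prop) : open O ->
  (forall u, P u -> forall x, O x -> {for x, continuous u}) ->
  (forall u, P u -> forall x i, O x -> derivable u x (delta_mx 0 i)) ->
  (forall u i, P u -> exists2 v, P v & forall x, O x -> partial i u x = v x) ->
  forall u, P u -> smooth_on O u.
Proof.
move=> oO Pc Pd Pp u Pu s.
have [v Pv uv] : exists2 v, P v & forall x, O x -> iter_partial s u x = v x.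
  elim: s => [|i s [v Pv uv]]; first by exists u.
  have [w Pw vw] := Pp v i Pv; exists w => // x Ox.
  by rewrite -vw //=; apply: (partial_ext _ oO Ox).
move=> x Ox; split.
  exact: (continuous_ext_on oO Ox uv (Pc v Pv x Ox)).
move=> i; apply: (@near_eq_derivable _ _ _ v); last exact: Pd.
by apply: near_open_eq Ox _ => // y /uv/esym.
Qed.

Lemma smooth_on_cst O (a : R) : open O -> smooth_on O (fun=> a).
Proof.
move=> oO; apply: (@smooth_on_coind O (fun u => exists b, u = cst b)) => //.
- by move=> u [b ->] x _; apply: cst_continuous.
- by move=> u [b ->] x i _; apply: derivable_cst.
- by move=> u i [b ->]; exists (cst 0) => [|x _]; [exists 0|apply: derive_cst].
- by exists a.
Qed.

(** Differentiating a product gives a sum of products, and differentiating an inverse gives a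
    product with inverses. No single operation is therefore stable under partial derivatives, but
    the generated algebra is, as [smooth_on_coind] requires. *)
Inductive smooth_alg O : ('rV[R]_n -> R) -> Prop :=
| SmoothBase u of smooth_on O u : smooth_alg O u
| SmoothAdd u v of smooth_alg O u & smooth_alg O v :
    smooth_alg O (fun x => u x + v x)
| SmoothMul u v of smooth_alg O u & smooth_alg O v :
    smooth_alg O (fun x => u x * v x)
| SmoothInv u of smooth_alg O u & (forall x, O x -> u x != 0) :
    smooth_alg O (fun x => (u x)^-1).

Lemma smooth_alg_continuous O u : smooth_alg O u ->
  forall x, O x -> {for x, continuous u}.
Proof.
move=> au x Ox; elim: au => {}u.
- by move=> su; apply: smooth_on_continuous Ox.
- by move=> v _ cu _ cv; exact: (@continuousD R _ _ u v).
- by move=> v _ cu _ cv; exact: continuousM.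
- by move=> _ cu u0; exact: (continuousV (u0 x Ox) cu).
Qed.

Lemma smooth_alg_derivable O u : smooth_alg O u ->
  forall x i, O x -> derivable u x (delta_mx 0 i).
Proof.
move=> au x i Ox; elim: au => {}u.
- by move=> su; apply: smooth_on_derivable Ox.
- by move=> v _ cu _ cv; exact: (@derivableD R _ _ u v).
- by move=> v _ cu _ cv; exact: (@derivableM R _ u v).
- by move=> _ cu u0; exact: (@derivableV R _ u _ _ (u0 x Ox) cu).
Qed.

Lemma smooth_alg_smooth O u : open O -> smooth_alg O u -> smooth_on O u.
Proof.
move=> oO; apply: (smooth_on_coind oO).
- exact: smooth_alg_continuous.
- exact: smooth_alg_derivable.
move=> {}u i; elim=> {}u.
- move=> su; exists (partial i u) => //; apply: SmoothBase.
  exact: smooth_on_partial.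
- move=> v au [u' au' uu'] av [v' av' vv'].
  exists (fun x => u' x + v' x) => [|x Ox]; first exact: SmoothAdd.
  rewrite /partial (@deriveD R _ _ u v) ?uu' //.
  + by rewrite -uu' // -vv'.
  + exact: smooth_alg_derivable Ox.
  + exact: smooth_alg_derivable Ox.
- move=> v au [u' au' uu'] av [v' av' vv'].
  exists (fun x => u x * v' x + v x * u' x) => [|x Ox].
    by apply: SmoothAdd; apply: SmoothMul.
  rewrite -uu' // -vv' // /partial (@deriveM R _ u v) //.
  + exact: smooth_alg_derivable Ox.
  + exact: smooth_alg_derivable Ox.
- move=> au [u' au' uu'] u0.
  exists (fun x => -1 * u' x * ((u x)^-1 * (u x)^-1)) => [|x Ox].
    have aV := SmoothInv au u0.
    do ![apply: SmoothMul => //].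
    by apply: SmoothBase; apply: smooth_on_cst.
  rewrite -uu' // /partial (@deriveV R _ u) ?u0 //; last first.
    exact: smooth_alg_derivable Ox.
  by rewrite mulN1r mulNr scaleNr expr2 invfM /GRing.scale /= mulrC.
Qed.

Section Closure.
Variable O : set 'rV[R]_n.
Hypothesis oO : open O.

Lemma smooth_onD u v : smooth_on O u -> smooth_on O v ->
  smooth_on O (fun x => u x + v x).
Proof.
move=> su sv; apply: smooth_alg_smooth => //.
by apply: SmoothAdd; apply: SmoothBase.
Qed.

Lemma smooth_onM u v : smooth_on O u -> smooth_on O v ->
  smooth_on O (fun x => u x * v x).
Proof.
move=> su sv; apply: smooth_alg_smooth => //.
by apply: SmoothMul; apply: SmoothBase.
Qed.

Lemma smooth_onV u : smooth_on O u -> (forall x, O x -> u x != 0) ->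
  smooth_on O (fun x => (u x)^-1).
Proof.
move=> su u0; apply: smooth_alg_smooth => //.
by apply: SmoothInv => //; apply: SmoothBase.
Qed.

Lemma smooth_onN u : smooth_on O u -> smooth_on O (fun x => - u x).
Proof.
move=> su.
have -> : (fun x => - u x) = (fun x => -1 * u x) by apply/funext=> x; rewrite mulN1r.
by apply: smooth_onM => //; apply: smooth_on_cst.
Qed.

Lemma smooth_onB u v : smooth_on O u -> smooth_on O v ->
  smooth_on O (fun x => u x - v x).
Proof. by move=> su sv; apply: smooth_onD => //; apply: smooth_onN. Qed.

Lemma smooth_on_sum (I : Type) (r : seq I) (P : pred I) (F : I -> 'rV[R]_n -> R) :
  (forall i, smooth_on O (F i)) -> smooth_on O (fun x => \sum_(i <- r | P i) F i x).
Proof.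
move=> sF; elim: r => [|i r IH].
  rewrite (_ : (fun x => _) = cst 0); first exact: smooth_on_cst.
  by apply/funext => x; rewrite big_nil.
rewrite (_ : (fun x => _) = (fun x => (if P i then F i x else 0) +
   \sum_(i <- r | P i) F i x)).
  by apply: smooth_onD => //; case: (P i); [exact: sF|exact: smooth_on_cst].
by apply/funext => x; rewrite big_cons; case: ifP => //; rewrite add0r.
Qed.

Lemma smooth_on_prod (I : Type) (r : seq I) (F : I -> 'rV[R]_n -> R) :
  (forall i, smooth_on O (F i)) -> smooth_on O (fun x => \prod_(i <- r) F i x).
Proof.
move=> sF; elim: r => [|i r IH].
  rewrite (_ : (fun x => _) = cst 1); first exact: smooth_on_cst.
  by apply/funext => x; rewrite big_nil.
rewrite (_ : (fun x => _) = (fun x => F i x * \prod_(i <- r) F i x)).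
  exact: smooth_onM.
by apply/funext => x; rewrite big_cons.
Qed.

Lemma smooth_on_det m (A : 'rV[R]_n -> 'M[R]_m) :
  (forall i j, smooth_on O (fun x => A x i j)) -> smooth_on O (fun x => \det (A x)).
Proof.
move=> sA; apply: smooth_on_sum => s; apply: smooth_onM.
  exact: smooth_on_cst.
by apply: smooth_on_prod => i.
Qed.

(** Coinduction on the functions that agree on [O] with a smooth one: since [O] is open, partial
    derivatives at its points ignore values elsewhere. *)
Lemma smooth_on_eq u v : (forall x, O x -> u x = v x) -> smooth_on O u ->
  smooth_on O v.
Proof.
move=> uv su.
apply: (@smooth_on_coind O
  (fun w => exists2 w', smooth_on O w' & forall x, O x -> w x = w' x)) => //.
- move=> w [w' sw ww'] x Ox.
  exact: (continuous_ext_on oO Ox ww' (smooth_on_continuous sw Ox)).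
- move=> w [w' sw ww'] x i Ox.
  have ww x' : O x' -> w' x' = w x' by move/ww'.
  apply: (@near_eq_derivable _ _ _ w'); last exact: smooth_on_derivable Ox.
  exact: near_open_eq Ox _.
- move=> w i [w' sw ww'].
  exists (partial i w'); first by exists (partial i w') => //; exact: smooth_on_partial.
  by move=> x Ox; apply: (partial_ext _ oO Ox).
- by exists u => // x Ox; rewrite uv.
Qed.

(** Cramer's rule: the entries of the inverse are cofactors divided by the determinant. *)
Lemma smooth_on_invmx m (A : 'rV[R]_n -> 'M[R]_m) :
  (forall i j, smooth_on O (fun x => A x i j)) ->
  (forall x, O x -> A x \in unitmx) ->
  forall i j, smooth_on O (fun x => invmx (A x) i j).
Proof.
move=> sA uA i j.
have sE : smooth_on O (fun x => (\det (A x))^-1 * ((-1) ^+ (j + i) *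
    \det (row' j (col' i (A x))))).
  apply: smooth_onM; [apply: smooth_onV; first exact: smooth_on_det|].
    by move=> x /uA; rewrite unitmxE unitfE.
  apply: smooth_onM; first exact: smooth_on_cst.
  apply: smooth_on_det => k l.
  by apply: smooth_on_eq (sA (lift j k) (lift i l)) => x _; rewrite !mxE.
apply: smooth_on_eq sE => x Ox.
by rewrite /invmx uA // !mxE.
Qed.

End Closure.
End PartialDerivatives.

(** * Symmetry of second partial derivatives *)

Section LineDerivative.
Context {R : realType} {n : nat}.
Implicit Types (O : set 'rV[R]_n) (u : 'rV[R]_n -> R) (x e : 'rV[R]_n).

Lemma is_derive_line u x e (t : R) : derivable u (x + t *: e) e ->
  is_derive t 1 (fun s => u (x + s *: e)) ('D_e u (x + t *: e)).
Proof.
move=> du.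
have E : (fun h : R => h^-1 *: (u (x + (h *: (1 : R^o) + t) *: e) - u (x + t *: e))) =
         (fun h : R => h^-1 *: (u (h *: e + (x + t *: e)) - u (x + t *: e))).
  apply/funext => h; congr (_ *: (u _ - _)).
  by rewrite scalerDl addrCA -[(h *: 1) *: e]scalerA scale1r.
by apply: DeriveDef; rewrite /derivable /derive /= /shift /= E.
Qed.

Lemma mean_value_line u x e (t : R) : 0 < t ->
  (forall s, 0 <= s <= t -> derivable u (x + s *: e) e) ->
  exists2 s, 0 < s < t & u (x + t *: e) - u x = 'D_e u (x + s *: e) * t.
Proof.
move=> t0 du.
have [||s st E] := @MVT R (fun s => u (x + s *: e))
    (fun s => 'D_e u (x + s *: e)) 0 t t0.
- by move=> s; rewrite in_itv /= => /andP[s0 st];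
    apply: is_derive_line; apply: du; rewrite !ltW.
- apply: derivable_within_continuous => s; rewrite in_itv /= => st.
  by have [] := is_derive_line (du s st).
by exists s; move: st E; rewrite in_itv //= scale0r addr0 subr0.
Qed.

Lemma open_box O x : open O -> O x -> exists2 r : R, 0 < r &
  forall y : 'rV[R]_n, (forall k, `|y 0 k - x 0 k| < r) -> O y.
Proof.
move=> oO Ox; have : nbhs x O by apply: open_nbhs_nbhs.
move=> /nbhs_ballP[r /= r0 rO]; exists r => // y yr; apply: rO.
by split=> // i j; rewrite /ball /= (ord1 i) distrC.
Qed.

Lemma open_box2 O x : open O -> O x -> exists2 r : R, 0 < r &
  forall (i j : 'I_n) (s t : R), 0 <= s < r -> 0 <= t < r ->
    O (x + s *: delta_mx 0 i + t *: delta_mx 0 j).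
Proof.
move=> oO Ox; have [r r0 rO] := open_box oO Ox.
(* The directions [i] and [j] may coincide; the coordinate then moves by [s + t], which must stay
   below [r]. *)
exists (r / 2); first by rewrite divr_gt0.
move=> i j s t /andP[s0 sr] /andP[t0 tr]; apply: rO => k.
rewrite !mxE /= [x 0 k + _ + _ - _]addrC !addrA addNr add0r.

have H (a : bool) (w : R) : 0 <= w -> w < r / 2 -> 0 <= w * a%:R < r / 2.
  by case: a => w0 wr; rewrite ?mulr1 ?mulr0 ?w0 // lexx divr_gt0.
have := H (k == i) s s0 sr; have := H (k == j) t t0 tr.
move: (s * _) (t * _) => a b /andP[b0 b1] /andP[a0 a1].
by rewrite ger0_norm; lra.
Qed.


(** Two mean value theorems: first along direction [i] for the increment [v] of [u] in direction
    [j], then along direction [j] for [partial i u]. *)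
Lemma second_difference O u x (i j : 'I_n) (h : R) : smooth_on O u -> 0 < h ->
  (forall s t, 0 <= s <= h -> 0 <= t <= h ->
     O (x + s *: delta_mx 0 i + t *: delta_mx 0 j)) ->
  exists s t, [/\ 0 < s < h, 0 < t < h &
   u (x + h *: delta_mx 0 i + h *: delta_mx 0 j) - u (x + h *: delta_mx 0 i)
   - (u (x + h *: delta_mx 0 j) - u x) =
   partial j (partial i u) (x + s *: delta_mx 0 i + t *: delta_mx 0 j) * h * h].
Proof.
move=> su h0 Oh.
have hh : 0 <= h <= h by rewrite lexx ltW.
have h00 : 0 <= (0 : R) <= h by rewrite lexx ltW.
pose v y := u (y + h *: delta_mx 0 j) - u y.
have dsh y : O (y + h *: delta_mx 0 j) ->
    is_derive y (delta_mx 0 i) (fun z => u (z + h *: delta_mx 0 j))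
      ('D_(delta_mx 0 i) u (y + h *: delta_mx 0 j)).
  move=> Oy; have := smooth_on_derivable su Oy.
  have E : (fun k : R => k^-1 *: (u (k *: delta_mx 0 i + y + h *: delta_mx 0 j)
              - u (y + h *: delta_mx 0 j))) =
           (fun k : R => k^-1 *: (u (k *: delta_mx 0 i + (y + h *: delta_mx 0 j))
              - u (y + h *: delta_mx 0 j))).
    by apply/funext => k; rewrite addrA.
  move=> dy; apply: DeriveDef; rewrite /derivable /derive /= /shift /= E //.
  exact: dy.
have [|s sh E] := @mean_value_line v x (delta_mx 0 i) h h0.
  move=> s sh; have Os := Oh s h sh hh; have Os0 := Oh s 0 sh h00.
  rewrite scale0r addr0 in Os0.
  apply: (@derivableB _ _ _ (fun z => u (z + h *: delta_mx 0 j)) u).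
    by have [] := dsh _ Os.
  exact: smooth_on_derivable Os0.
have sh' : 0 <= s <= h by case/andP: sh => s0 s1; rewrite !ltW.
have [|t th E'] := @mean_value_line (partial i u) (x + s *: delta_mx 0 i) (delta_mx 0 j) h h0.
  move=> t th; apply: (smooth_on_derivable (smooth_on_partial i su)).
  exact: Oh.
exists s, t; split => //.
rewrite -E' -[LHS]/(v (x + h *: delta_mx 0 i) - v x) E; congr (_ * _).
have Os := Oh s h sh' hh; have Os0 := Oh s 0 sh' h00.
rewrite scale0r addr0 in Os0.
rewrite (@deriveB _ _ _ (fun z => u (z + h *: delta_mx 0 j)) u).
- by have [_ ->] := dsh _ Os.
- by have [] := dsh _ Os.
- exact: smooth_on_derivable Os0.
Qed.

Lemma continuous_box u x (e : R) : {for x, continuous u} -> 0 < e ->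
  exists2 r : R, 0 < r & forall (i j : 'I_n) (s t : R), 0 <= s < r -> 0 <= t < r ->
    `|u x - u (x + s *: delta_mx 0 i + t *: delta_mx 0 j)| < e.
Proof.
move=> cu e0.
have /nbhs_ballP[r0 /= r0p H] : nbhs x [set y | ball (u x) e (u y)].
  by apply: cu; apply: nbhsx_ballx.
have [||r rp rO] := @open_box2 (interior (ball x r0)) x.
- exact: open_interior.
- exact: (nbhsx_ballx x r0 r0p).
exists r => // i j s t sr tr; have := H _ (interior_subset (rO i j s t sr tr)).
by rewrite /ball /=.
Qed.

(** The second difference is symmetric in [i] and [j], so the two mixed derivatives share a value at
    points arbitrarily close to [x]. By continuity this value is within half of [|a - b|] of both
    [a] and [b], a contradiction if they differ. *)
Lemma partialC O u (i j : 'I_n) x : open O -> smooth_on O u -> O x ->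
  partial i (partial j u) x = partial j (partial i u) x.
Proof.
move=> oO su Ox; apply/eqP/negPn/negP => neq.
set a := partial i (partial j u) x; set b := partial j (partial i u) x.
have e0 : 0 < `|a - b| / 2 by rewrite divr_gt0 // normr_gt0 subr_eq0.
have [r1 r1p H1] := continuous_box (smooth_on_continuous
  (smooth_on_partial i (smooth_on_partial j su)) Ox) e0.
have [r2 r2p H2] := continuous_box (smooth_on_continuous
  (smooth_on_partial j (smooth_on_partial i su)) Ox) e0.
have [r3 r3p H3] := open_box2 oO Ox.
(* Half of the minimum, so that the closed square of side [h] lies in all three half-open boxes. *)
pose h := Num.min r1 (Num.min r2 r3) / 2.
have hm : 0 < Num.min r1 (Num.min r2 r3) by rewrite !lt_min r1p r2p r3p.
have h0 : 0 < h by rewrite divr_gt0.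
have : h < Num.min r1 (Num.min r2 r3) by rewrite ltr_pdivrMr // mulr_natr mulr2n ltrDl.
rewrite !lt_min => /and3P[hr1 hr2 hr3].
have [|s [t [sh th E]]] := @second_difference O u x i j h su h0.
  move=> s t /andP[s0 s1] /andP[t0 t1].
  by apply: H3; rewrite ?s0 ?t0 /= ?(le_lt_trans s1) ?(le_lt_trans t1).
have [|s' [t' [sh' th' E']]] := @second_difference O u x j i h su h0.
  move=> s' t' /andP[s0 s1] /andP[t0 t1].
  by apply: H3; rewrite ?s0 ?t0 /= ?(le_lt_trans s1) ?(le_lt_trans t1).
have W (q w : R) : 0 < q < h -> h < w -> 0 <= q < w.
  by move=> /andP[q0 qh] hw; rewrite ltW //= (lt_trans qh).
have A1 := H1 j i s' t' (W _ _ sh' hr1) (W _ _ th' hr1).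
have A2 := H2 i j s t (W _ _ sh hr2) (W _ _ th hr2).
have EE : partial j (partial i u) (x + s *: delta_mx 0 i + t *: delta_mx 0 j) =
          partial i (partial j u) (x + s' *: delta_mx 0 j + t' *: delta_mx 0 i).
  have hI (p q : R) : p * h * h = q * h * h -> p = q.
    by move=> pq; apply: (mulIf (lt0r_neq0 h0)); apply: (mulIf (lt0r_neq0 h0)).
  apply: hI; apply: etrans (esym E) _; apply: etrans _ E'.
  rewrite [x + h *: delta_mx 0 j + _]addrAC.
  move: (u _) (u _) (u _) (u _) => p q w z; ring.
rewrite EE in A2.
rewrite -/a in A1; rewrite -/b in A2.
move: (partial i _ _) A1 A2 => w A1 A2.
have := ler_distD w a b; rewrite [`|w - b|]distrC => A3.
have := le_lt_trans A3 (ltrD A1 A2).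
by rewrite -splitr ltxx.
Qed.

Lemma partial0_line O u x (i : 'I_n) (t : R) : smooth_on O u ->
  (forall y, O y -> partial i u y = 0) -> 0 <= t ->
  (forall s, 0 <= s <= t -> O (x + s *: delta_mx 0 i)) ->
  u (x + t *: delta_mx 0 i) = u x.
Proof.
move=> su du0; rewrite le_eqVlt => /predU1P[<- _|t0 Ot].
  by rewrite scale0r addr0.
have [|s /andP[s0 st] E] := @mean_value_line u x (delta_mx 0 i) t t0.
  by move=> s /Ot Os; apply: smooth_on_derivable Os.
apply/eqP; rewrite -subr_eq0 E [X in X * _]du0 ?mul0r //.
by apply: Ot; rewrite !ltW.
Qed.

Lemma partial0_locally_constant O u x : open O -> smooth_on O u ->
  (forall i y, O y -> partial i u y = 0) -> O x ->
  \forall y \near x, u y = u x.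
Proof.
move=> oO su du0 Ox; have [r r0 rO] := open_box oO Ox.
have : nbhs x (ball x r) := nbhsx_ballx x r r0.
apply: filterS => y /= [_ yr].
(* The path from [x] to [y] changes one coordinate at a time: [z m] already has the first [m]
   coordinates of [y]. It stays in the box around [x]. *)
pose z m : 'rV[R]_n := \row_k (if (k < m)%N then y 0 k else x 0 k).
have Oz m (i : 'I_n) s : `|s - x 0 i| < r ->
    O (\row_k (if k == i then s else z m 0 k)).
  move=> sr; apply: rO => k; rewrite !mxE; case: eqP => [->//|_].
  case: ifP => _; last by rewrite subrr normr0.
  by have := yr 0 k; rewrite /ball /= distrC.
have zu m : (m <= n)%N -> u (z m) = u x.
  elim: m => [_|m IH mn].
    by congr u; apply/rowP => k; rewrite !mxE ltn0.
  rewrite -IH ?(ltnW mn) //.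
  pose i := Ordinal mn.
  have yi : `|y 0 i - x 0 i| < r by have := yr 0 i; rewrite /ball /= distrC.
  have zi : z m 0 i = x 0 i by rewrite mxE ltnn.
  have zSi : z m.+1 0 i = y 0 i by rewrite mxE ltnSn.
  have zE k : k != i -> z m.+1 0 k = z m 0 k.
    by move=> ki; rewrite !mxE ltnS leq_eqVlt (negbTE (ki : k != m :> nat)).
  have [xy|/ltW yx] := leP (x 0 i) (y 0 i).
    have -> : z m.+1 = z m + (y 0 i - x 0 i) *: delta_mx 0 i.
      apply/rowP => k; rewrite [RHS]mxE [X in _ + X]mxE [delta_mx _ _ _ _]mxE /=.
      have [->|/zE ->] := eqVneq k i; last by rewrite mulr0 addr0.
      by rewrite zSi zi mulr1 addrC subrK.
    apply: partial0_line su (du0 i) _ _; first by rewrite subr_ge0.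
    move=> s /andP[s0 s1].
    have -> : z m + s *: delta_mx 0 i = \row_k (if k == i then x 0 i + s else z m 0 k).
      apply/rowP => k; rewrite [LHS]mxE [X in _ + X]mxE [delta_mx _ _ _ _]mxE /= [RHS]mxE.
      have [->|_] := eqVneq k i; last by rewrite mulr0 addr0.
      by rewrite zi mulr1.
    apply: Oz; rewrite addrC addKr.
    by move: yi; rewrite !ger0_norm ?subr_ge0 //; apply: le_lt_trans.
  (* [partial0_line] only moves in the positive direction, so when the coordinate decreases the
     segment is run backwards. *)
  have -> : z m = z m.+1 + (x 0 i - y 0 i) *: delta_mx 0 i.
    apply/rowP => k; rewrite [RHS]mxE [X in _ + X]mxE [delta_mx _ _ _ _]mxE /=.
    have [->|/zE ->] := eqVneq k i; last by rewrite mulr0 addr0.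
    by rewrite zSi zi mulr1 addrC subrK.
  apply/esym; apply: partial0_line su (du0 i) _ _; first by rewrite subr_ge0.
  move=> s /andP[s0 s1].
  have -> : z m.+1 + s *: delta_mx 0 i = \row_k (if k == i then y 0 i + s else z m 0 k).
    apply/rowP => k; rewrite [LHS]mxE [X in _ + X]mxE [delta_mx _ _ _ _]mxE /= [RHS]mxE.
    have [->|/zE ->] := eqVneq k i; last by rewrite mulr0 addr0.
    by rewrite zSi mulr1.
  apply: Oz; move: yi; rewrite ler0_norm ?subr_le0 // => yi.
  by rewrite ler0_norm; lra.
rewrite -(zu n (leqnn n)); congr u.
by apply/rowP => k; rewrite mxE ltn_ord.
Qed.

End LineDerivative.

(** * Complex-valued functions *)

Section ComplexCalculus.
Context {R : realType} {n : nat}.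
Implicit Types (u v : 'rV[R]_n -> R[i]) (x : 'rV[R]_n).
Local Open Scope complex_scope.

Lemma ReD (a b : R[i]) : complex.Re (a + b) = complex.Re a + complex.Re b.
Proof. by case: a b => ? ? []. Qed.

Lemma ImD (a b : R[i]) : complex.Im (a + b) = complex.Im a + complex.Im b.
Proof. by case: a b => ? ? []. Qed.

Lemma ReM (a b : R[i]) : complex.Re (a * b) =
  complex.Re a * complex.Re b - complex.Im a * complex.Im b.
Proof. by case: a b => ? ? []. Qed.

Lemma ImM (a b : R[i]) : complex.Im (a * b) =
  complex.Re a * complex.Im b + complex.Im a * complex.Re b.
Proof. by case: a b => ? ? []. Qed.

Lemma complex_eq (a b : R[i]) : complex.Re a = complex.Re b ->
  complex.Im a = complex.Im b -> a = b.
Proof. by case: a b => ? ? [? ?] /= -> ->. Qed.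

Variable O : set 'rV[R]_n.
Hypothesis oO : open O.

Lemma csmooth_on_eq u v : (forall x, O x -> u x = v x) -> csmooth_on O u ->
  csmooth_on O v.
Proof.
by move=> uv [su1 su2]; split;
  [apply: (smooth_on_eq oO _ su1)|apply: (smooth_on_eq oO _ su2)] => x /uv ->.
Qed.

Lemma csmooth_on_cst (a : R[i]) : csmooth_on O (fun=> a).
Proof. by split; apply: smooth_on_cst. Qed.

Lemma csmooth_on_real (a : 'rV[R]_n -> R) : smooth_on O a ->
  csmooth_on O (fun x => (a x)%:C).
Proof. by move=> sa; split => //=; apply: smooth_on_cst. Qed.

Lemma csmooth_onD u v : csmooth_on O u -> csmooth_on O v ->
  csmooth_on O (fun x => u x + v x).
Proof.
move=> [u1 u2] [v1 v2]; split.
  by apply: (smooth_on_eq oO _ (smooth_onD oO u1 v1)) => x _; rewrite ReD.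
by apply: (smooth_on_eq oO _ (smooth_onD oO u2 v2)) => x _; rewrite ImD.
Qed.

Lemma csmooth_onM u v : csmooth_on O u -> csmooth_on O v ->
  csmooth_on O (fun x => u x * v x).
Proof.
move=> [u1 u2] [v1 v2]; split.
  apply: (smooth_on_eq oO _ (smooth_onB oO (smooth_onM oO u1 v1)
    (smooth_onM oO u2 v2))) => x _; by rewrite ReM.
apply: (smooth_on_eq oO _ (smooth_onD oO (smooth_onM oO u1 v2)
  (smooth_onM oO u2 v1))) => x _; by rewrite ImM.
Qed.

Lemma csmooth_on_sum (I : Type) (r : seq I) (P : pred I) (F : I -> 'rV[R]_n -> R[i]) :
  (forall i, csmooth_on O (F i)) ->
  csmooth_on O (fun x => \sum_(i <- r | P i) F i x).
Proof.
move=> sF; elim: r => [|i r IH].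
  by apply: (csmooth_on_eq _ (csmooth_on_cst 0)) => x _; rewrite big_nil.
have sFi : csmooth_on O (fun x => if P i then F i x else 0).
  by case: (P i); [exact: sF|exact: csmooth_on_cst].
apply: (csmooth_on_eq _ (csmooth_onD sFi IH)) => x _.
by rewrite big_cons; case: ifP => //; rewrite add0r.
Qed.

Lemma csmooth_on_partial i u : csmooth_on O u -> csmooth_on O (cpartial i u).
Proof. by move=> [u1 u2]; split; apply: smooth_on_partial. Qed.

Lemma cpartial_ext i u v x : O x -> (forall y, O y -> u y = v y) ->
  cpartial i u x = cpartial i v x.
Proof.
by move=> Ox uv; congr (_ +i* _); apply: (partial_ext _ oO Ox) => y /uv ->.
Qed.

Lemma cpartial_cst i (a : R[i]) x : cpartial i (fun=> a) x = 0.
Proof.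
by apply: complex_eq => /=; apply: derive_cst.
Qed.

Lemma cpartial_real i (a : 'rV[R]_n -> R) x :
  cpartial i (fun y => (a y)%:C) x = (partial i a x)%:C.
Proof. by apply: complex_eq => //=; apply: derive_cst. Qed.

Lemma partialD i (a b : 'rV[R]_n -> R) x : smooth_on O a -> smooth_on O b -> O x ->
  partial i (fun y => a y + b y) x = partial i a x + partial i b x.
Proof.
move=> sa sb Ox.
exact: (deriveD (smooth_on_derivable sa Ox) (smooth_on_derivable sb Ox)).
Qed.

Lemma partialB i (a b : 'rV[R]_n -> R) x : smooth_on O a -> smooth_on O b -> O x ->
  partial i (fun y => a y - b y) x = partial i a x - partial i b x.
Proof.
move=> sa sb Ox.
exact: (deriveB (smooth_on_derivable sa Ox) (smooth_on_derivable sb Ox)).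
Qed.

Lemma partialM i (a b : 'rV[R]_n -> R) x : smooth_on O a -> smooth_on O b -> O x ->
  partial i (fun y => a y * b y) x = partial i a x * b x + a x * partial i b x.
Proof.
move=> sa sb Ox; rewrite addrC [partial i a x * _]mulrC.
exact: (deriveM (smooth_on_derivable sa Ox) (smooth_on_derivable sb Ox)).
Qed.

Lemma cpartialD i u v x : csmooth_on O u -> csmooth_on O v -> O x ->
  cpartial i (fun y => u y + v y) x = cpartial i u x + cpartial i v x.
Proof.
move=> [u1 u2] [v1 v2] Ox; apply: complex_eq; rewrite ?ReD ?ImD /=.
  rewrite -partialD //; congr (partial _ _ _).
  by apply/funext => y; rewrite ReD.
rewrite -partialD //; congr (partial _ _ _).
by apply/funext => y; rewrite ImD.
Qed.

Lemma cpartialM i u v x : csmooth_on O u -> csmooth_on O v -> O x ->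
  cpartial i (fun y => u y * v y) x = cpartial i u x * v x + u x * cpartial i v x.
Proof.
move=> [u1 u2] [v1 v2] Ox; apply: complex_eq; rewrite ?ReD ?ImD ?ReM ?ImM /=.
  under [X in partial _ X _]eq_fun do rewrite ReM.
  rewrite (partialB i (smooth_onM oO u1 v1) (smooth_onM oO u2 v2) Ox).
  rewrite (partialM i u1 v1 Ox) (partialM i u2 v2 Ox).
  move: (partial _ _ _) (partial _ _ _) (partial _ _ _) (partial _ _ _) => a b c d.
  move: (complex.Re _) (complex.Im _) (complex.Re _) (complex.Im _) => p q r s; ring.
under [X in partial _ X _]eq_fun do rewrite ImM.
rewrite (partialD i (smooth_onM oO u1 v2) (smooth_onM oO u2 v1) Ox).
rewrite (partialM i u1 v2 Ox) (partialM i u2 v1 Ox).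
move: (partial _ _ _) (partial _ _ _) (partial _ _ _) (partial _ _ _) => a b c d.
move: (complex.Re _) (complex.Im _) (complex.Re _) (complex.Im _) => p q r s; ring.
Qed.

Lemma cpartial_sum (I : Type) (r : seq I) (P : pred I) (F : I -> 'rV[R]_n -> R[i]) i x :
  (forall k, csmooth_on O (F k)) -> O x ->
  cpartial i (fun y => \sum_(k <- r | P k) F k y) x =
  \sum_(k <- r | P k) cpartial i (F k) x.
Proof.
move=> sF Ox; elim: r => [|k r IH].
  rewrite big_nil; apply: etrans (cpartial_cst i 0 x).
  by apply: cpartial_ext => // y _; rewrite big_nil.
have sFi : csmooth_on O (fun x => if P k then F k x else 0).
  by case: (P k); [exact: sF|exact: csmooth_on_cst].
rewrite big_cons -IH.
transitivity (cpartial i (fun y => (if P k then F k y else 0) +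
    \sum_(j <- r | P j) F j y) x).
  by apply: cpartial_ext => // y _; rewrite big_cons; case: ifP; rewrite ?add0r.
rewrite (cpartialD i sFi (csmooth_on_sum _ _ sF) Ox).
by case: (P k) => //; rewrite cpartial_cst add0r.
Qed.

Lemma partial_sum (I : Type) (r : seq I) (F : I -> 'rV[R]_n -> R) i x :
  (forall k, smooth_on O (F k)) -> O x ->
  partial i (fun y => \sum_(k <- r) F k y) x = \sum_(k <- r) partial i (F k) x.
Proof.
move=> sF Ox; apply: (@complexI R); rewrite -cpartial_real rmorph_sum /=.
transitivity (cpartial i (fun y => \sum_(k <- r) (F k y)%:C) x).
  by apply: cpartial_ext => // y _; rewrite -rmorph_sum.
rewrite cpartial_sum //; last by move=> k; apply: csmooth_on_real.
by apply: eq_bigr => k _; rewrite cpartial_real.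
Qed.

Lemma cpartialC i j u x : csmooth_on O u -> O x ->
  cpartial i (cpartial j u) x = cpartial j (cpartial i u) x.
Proof.
move=> [u1 u2] Ox; apply: complex_eq.
  exact: (@partialC _ _ O (fun y => complex.Re (u y)) i j x oO u1 Ox).
exact: (@partialC _ _ O (fun y => complex.Im (u y)) i j x oO u2 Ox).
Qed.

End ComplexCalculus.

Lemma csmooth_on_sub (R : realType) (n : nat) (O O' : set 'rV[R]_n)
    (u : 'rV[R]_n -> R[i]) : O' `<=` O -> csmooth_on O u -> csmooth_on O' u.
Proof. by move=> OO [u1 u2]; split; apply: smooth_on_sub OO _. Qed.

(** * Tensors indexed by tuples *)

Section TupleTensors.
Context {F : comNzRingType} {n : nat}.
Implicit Types (A B h : 'I_n -> 'I_n -> F).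

(** Slot [t] of the result reads slot [s t]. As products of permutations apply the left factor
    first, [permuteM] keeps the order of the factors. *)
Definition permute r (s : 'S_r) (I : r.-tuple 'I_n) : r.-tuple 'I_n :=
  [tuple tnth I (s t) | t < r].

(* The action of the matrix [A] on tensors by derivations. *)
Definition slot A r (T : r.-tuple 'I_n -> F) (I : r.-tuple 'I_n) : F :=
  \sum_(s < r) \sum_(l < n) A (tnth I s) l * T (replace_at I s l).

(** Insertion here, and contraction in [contr2], always use the first two slots; other positions are
    reached through [permute]. *)
Definition tens2 h r (T : r.-tuple 'I_n -> F) (I : r.+2.-tuple 'I_n) : F :=
  h (tnth I ord0) (tnth I (lift ord0 ord0)) * T (behead_tuple (behead_tuple I)).

Definition contr2 h r (T : r.+2.-tuple 'I_n -> F) (J : r.-tuple 'I_n) : F :=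
  \sum_a \sum_b h a b * T [tuple of a :: b :: J].

Lemma sum_tuple0 (G : 0.-tuple 'I_n -> F) : \sum_I G I = G [tuple].
Proof.
by rewrite (big_pred1 [tuple]) // => I; apply/esym/eqP; rewrite tuple0; apply/tuple0.
Qed.

Lemma sum_tuple_cons r (G : r.+1.-tuple 'I_n -> F) :
  \sum_I G I = \sum_a \sum_(J : r.-tuple 'I_n) G [tuple of a :: J].
Proof.
rewrite pair_big /= (reindex (fun p : 'I_n * r.-tuple 'I_n => [tuple of p.1 :: p.2])) //=.
exists (fun I => (thead I, behead_tuple I)) => [[a J] _|I _] /=.
  by rewrite theadE; congr pair; apply: val_inj.
by rewrite [RHS]tuple_eta; apply: val_inj.
Qed.

Lemma replace_at_cons0 r (a l : 'I_n) (J : r.-tuple 'I_n) :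
  replace_at [tuple of a :: J] ord0 l = [tuple of l :: J].
Proof.
apply: eq_from_tnth => t; rewrite tnth_mktuple.
by have [t'|] := unliftP ord0 t => ->; rewrite ?eqxx ?tnth0 // !tnthS.
Qed.

Lemma replace_at_consS r (a l : 'I_n) (J : r.-tuple 'I_n) s :
  replace_at [tuple of a :: J] (lift ord0 s) l = [tuple of a :: replace_at J s l].
Proof.
apply: eq_from_tnth => t; rewrite tnth_mktuple.
have [t'|] := unliftP ord0 t => ->; rewrite ?tnth0 ?tnthS //.
by rewrite tnth_mktuple (inj_eq lift_inj).
Qed.

Lemma slot_cons A r (T : r.+1.-tuple 'I_n -> F) a (J : r.-tuple 'I_n) :
  slot A T [tuple of a :: J] =
  \sum_l A a l * T [tuple of l :: J] + slot A (fun K => T [tuple of a :: K]) J.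
Proof.
rewrite /slot big_ord_recl tnth0; congr (_ + _).
  by apply: eq_bigr => l _; rewrite replace_at_cons0.
apply: eq_bigr => s _; apply: eq_bigr => l _.
by rewrite tnthS replace_at_consS.
Qed.

Lemma slot0 A (T : 0.-tuple 'I_n -> F) I : slot A T I = 0.
Proof. by rewrite /slot big_ord0. Qed.

Lemma eq_slot A A' r (T T' : r.-tuple 'I_n -> F) I :
  (forall k l, A k l = A' k l) -> (forall J, T J = T' J) -> slot A T I = slot A' T' I.
Proof. by move=> eA eT; do 2!apply: eq_bigr => ? _; rewrite eA eT. Qed.

Lemma slotD A r (T T' : r.-tuple 'I_n -> F) I :
  slot A (fun J => T J + T' J) I = slot A T I + slot A T' I.
Proof.
rewrite /slot -big_split; apply: eq_bigr => s _; rewrite -big_split.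
by apply: eq_bigr => l _; rewrite mulrDr.
Qed.

Lemma slot_sum A r (K : Type) (q : seq K) (T : K -> r.-tuple 'I_n -> F) I :
  slot A (fun J => \sum_(k <- q) T k J) I = \sum_(k <- q) slot A (T k) I.
Proof.
rewrite /slot [RHS]exchange_big; apply: eq_bigr => s _; rewrite [RHS]exchange_big.
by apply: eq_bigr => l _; rewrite big_distrr.
Qed.

Lemma slotZ A r c (T : r.-tuple 'I_n -> F) I :
  slot A (fun J => c * T J) I = c * slot A T I.
Proof.
rewrite /slot big_distrr; apply: eq_bigr => s _; rewrite big_distrr.
by apply: eq_bigr => l _; rewrite /= mulrCA.
Qed.

Lemma slotDl A B r (T : r.-tuple 'I_n -> F) I :
  slot (fun k l => A k l + B k l) T I = slot A T I + slot B T I.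
Proof.
rewrite /slot -big_split; apply: eq_bigr => s _; rewrite -big_split.
by apply: eq_bigr => l _; rewrite mulrDl.
Qed.

Lemma slotNl A r (T : r.-tuple 'I_n -> F) I :
  slot (fun k l => - A k l) T I = - slot A T I.
Proof.
rewrite /slot -sumrN; apply: eq_bigr => s _; rewrite -sumrN.
by apply: eq_bigr => l _; rewrite mulNr.
Qed.

Lemma slotZl c A r (T : r.-tuple 'I_n -> F) I :
  slot (fun k l => c * A k l) T I = c * slot A T I.
Proof.
rewrite /slot big_distrr; apply: eq_bigr => s _; rewrite big_distrr.
by apply: eq_bigr => l _; rewrite /= mulrA.
Qed.

(* Operators acting on different slots commute, so only the terms in which both
   act on the same slot survive in the commutator. *)
Lemma slot_commutator A B r (T : r.-tuple 'I_n -> F) I :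
  slot A (slot B T) I - slot B (slot A T) I =
  slot (fun k l => \sum_m (A k m * B m l - B k m * A m l)) T I.
Proof.
elim: r => [|r IH] in T I *; first by rewrite !slot0 subr0.
case/tupleP: I => a J.
have E C D : slot C (slot D T) [tuple of a :: J] =
    \sum_l (\sum_m C a m * D m l) * T [tuple of l :: J]
    + \sum_l C a l * slot D (fun K => T [tuple of l :: K]) J
    + \sum_l D a l * slot C (fun K => T [tuple of l :: K]) J
    + slot C (slot D (fun K => T [tuple of a :: K])) J.
  rewrite slot_cons.
  under eq_bigr do rewrite slot_cons mulrDr.
  rewrite big_split /= -!addrA; congr (_ + _).
    under eq_bigr do rewrite big_distrr /=.
    rewrite exchange_big; apply: eq_bigr => l _; rewrite big_distrl.
    by apply: eq_bigr => m _; rewrite mulrA.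
  congr (_ + _).
  rewrite -(eq_slot (T := fun K => \sum_l D a l * T [tuple of l :: K]
    + slot D (fun K => T [tuple of a :: K]) K) (A := C)) //; last first.
    by move=> K; rewrite slot_cons.
  rewrite slotD slot_sum; congr (_ + _).
  by apply: eq_bigr => l _; rewrite slotZ.
rewrite !E slot_cons -IH.
have -> : \sum_l (\sum_m (A a m * B m l - B a m * A m l)) * T [tuple of l :: J] =
    \sum_l (\sum_m A a m * B m l) * T [tuple of l :: J]
    - \sum_l (\sum_m B a m * A m l) * T [tuple of l :: J].
  by rewrite -sumrB; apply: eq_bigr => l _; rewrite sumrB mulrBl.
move: (slot _ _ _) (slot _ _ _) (\sum_l _) (\sum_l _) (\sum_l _) (\sum_l _) => p q s t u v.
ring.
Qed.

(** Passing a derivation to the other factor of a pairing transposes its matrix. This is why the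
    connection on covariant tensors is minus the transpose, see [dual_connection]. *)
Lemma slot_adjoint A r (T W : r.-tuple 'I_n -> F) :
  \sum_I slot A T I * W I = \sum_I T I * slot (fun k l => A l k) W I.
Proof.
elim: r => [|r IH] in T W *.
  by rewrite !sum_tuple0 !slot0 mul0r mulr0.
rewrite !sum_tuple_cons.
under eq_bigr do under eq_bigr do rewrite slot_cons mulrDl.
under [RHS]eq_bigr do under eq_bigr do rewrite slot_cons mulrDr.
under eq_bigr do rewrite big_split.
under [RHS]eq_bigr do rewrite big_split.
rewrite !big_split /=; congr (_ + _); last first.
  by apply: eq_bigr => a _; apply: IH.
rewrite exchange_big [RHS]exchange_big; apply: eq_bigr => J _.
under eq_bigr do rewrite big_distrl.
under [RHS]eq_bigr do rewrite big_distrr.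
rewrite exchange_big /=; apply: eq_bigr => l _; apply: eq_bigr => a _.
by rewrite [A a l * _]mulrC -mulrA.
Qed.

Lemma permuteM r (s t : 'S_r) (I : r.-tuple 'I_n) :
  permute s (permute t I) = permute (s * t)%g I.
Proof. by apply: eq_from_tnth => k; rewrite !tnth_mktuple permM. Qed.

Lemma permute1 r (I : r.-tuple 'I_n) : permute 1 I = I.
Proof. by apply: eq_from_tnth => k; rewrite !tnth_mktuple perm1. Qed.

Lemma permuteK r (s : 'S_r) : cancel (permute s) (permute s^-1)%g.
Proof. by move=> I; rewrite permuteM mulVg permute1. Qed.

Lemma permuteVK r (s : 'S_r) : cancel (permute s^-1)%g (permute s).
Proof. by move=> I; rewrite permuteM mulgV permute1. Qed.

Lemma sum_permute r (s : 'S_r) (G : r.-tuple 'I_n -> F) :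
  \sum_I G (permute s I) = \sum_I G I.
Proof.
rewrite [RHS](reindex (permute s)) //.
by exists (permute s^-1)%g => I _; rewrite ?permuteK ?permuteVK.
Qed.

Lemma permute_replace_at r (s : 'S_r) (I : r.-tuple 'I_n) t l :
  permute s (replace_at I (s t) l) = replace_at (permute s I) t l.
Proof.
by apply: eq_from_tnth => k; rewrite !tnth_mktuple (inj_eq perm_inj).
Qed.

Lemma slot_permute A r (s : 'S_r) (T : r.-tuple 'I_n -> F) I :
  slot A (fun J => T (permute s J)) I = slot A T (permute s I).
Proof.
rewrite /slot (reindex_perm s) /=; apply: eq_bigr => t _; apply: eq_bigr => l _.
by rewrite permute_replace_at tnth_mktuple.
Qed.

Lemma tens2_cons h r (T : r.-tuple 'I_n -> F) a b (J : r.-tuple 'I_n) :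
  tens2 h T [tuple of a :: b :: J] = h a b * T J.
Proof.
rewrite /tens2 tnth0 tnthS tnth0; congr (_ * T _); exact: val_inj.
Qed.

Lemma tuple_eta2 r (I : r.+2.-tuple 'I_n) :
  exists a b (J : r.-tuple 'I_n), I = [tuple of a :: b :: J].
Proof.
case/tupleP: I => a I; case/tupleP: I => b J; by exists a, b, J.
Qed.

Lemma slot_tens2 A h r (T : r.-tuple 'I_n -> F) a b (J : r.-tuple 'I_n) :
  slot A (tens2 h T) [tuple of a :: b :: J] =
  (\sum_l A a l * h l b + \sum_l A b l * h a l) * T J + h a b * slot A T J.
Proof.
rewrite !slot_cons mulrDl !big_distrl /= -addrA; congr (_ + _).
  by apply: eq_bigr => l _; rewrite tens2_cons mulrA.
congr (_ + _); first by apply: eq_bigr => l _; rewrite tens2_cons mulrA.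
by rewrite -slotZ; apply: eq_slot => // K; rewrite tens2_cons.
Qed.

(** A Leibniz rule: the subtracted sum is what the derivation does to [h], whose indices are
    covariant and therefore see the transpose of [A]. *)
Lemma slot_contr2 A h r (T : r.+2.-tuple 'I_n -> F) J :
  slot A (contr2 h T) J = contr2 h (slot A T) J -
  \sum_a \sum_b (\sum_l A l a * h l b + \sum_l A l b * h a l) * T [tuple of a :: b :: J].
Proof.
apply/eqP; rewrite eq_sym subr_eq; apply/eqP.
have -> : slot A (contr2 h T) J =
    \sum_a \sum_b h a b * slot A (fun K => T [tuple of a :: b :: K]) J.
  rewrite /contr2 slot_sum; apply: eq_bigr => a _.
  by rewrite slot_sum; apply: eq_bigr => b _; rewrite slotZ.
rewrite /contr2 [RHS]addrC.
under eq_bigr do under eq_bigr do rewrite !slot_cons addrA mulrDr.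
under eq_bigr do rewrite big_split.
rewrite big_split /=; congr (_ + _).
under eq_bigr do under eq_bigr do rewrite mulrDr !big_distrr /=.
under [RHS]eq_bigr do under eq_bigr do rewrite mulrDl !big_distrl /=.
under eq_bigr do rewrite big_split.
under [RHS]eq_bigr do rewrite big_split.
rewrite !big_split /=; congr (_ + _).
  rewrite exchange_big [RHS]exchange_big; apply: eq_bigr => b _.
  rewrite exchange_big; apply: eq_bigr => a _; apply: eq_bigr => l _ /=.
  by rewrite mulrCA mulrA.
apply: eq_bigr => a _; rewrite exchange_big; apply: eq_bigr => l _.
by apply: eq_bigr => b _; rewrite mulrCA mulrA.
Qed.

End TupleTensors.

(** * Tensors invariant under infinitesimal rotations *)

Section OrthogonalInvariance.
Context {F : comNzRingType} {n : nat}.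

Definition lift0_perm r (s : 'S_r) : 'S_r.+1 := lift_perm ord0 ord0 s.

Lemma permute_lift0 r (s : 'S_r) (a : 'I_n) (J : r.-tuple 'I_n) :
  permute (lift0_perm s) [tuple of a :: J] = [tuple of a :: permute s J].
Proof.
apply: eq_from_tnth => t; rewrite tnth_mktuple.
have [u|] := unliftP ord0 t => ->; rewrite ?lift_perm_lift ?lift_perm_id ?tnth0 //.
by rewrite !tnthS tnth_mktuple.
Qed.

Lemma permute_tperm0 r (k : 'I_n) (J : r.-tuple 'I_n) s :
  permute (tperm ord0 (lift ord0 s)) [tuple of k :: J] =
  [tuple of tnth J s :: replace_at J s k].
Proof.
apply: eq_from_tnth => t; rewrite tnth_mktuple.
have [u|] := unliftP ord0 t => ->; last by rewrite tpermL tnth0 tnthS.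
rewrite tnthS tnth_mktuple; have [->|us] := eqVneq u s.
  by rewrite tpermR tnth0.
by rewrite tpermD ?tnthS // ?neq_lift // (inj_eq lift_inj) eq_sym.
Qed.

Lemma sum_permute_involution r (s : 'S_r) (A B : r.-tuple 'I_n -> F) :
  (s^-1 = s)%g -> \sum_I A (permute s I) * B I = \sum_I A I * B (permute s I).
Proof.
move=> sV; have s2 : (s * s = 1)%g by rewrite -{1}sV mulVg.
rewrite -[RHS](sum_permute s); apply: eq_bigr => I _.
by rewrite permuteM s2 permute1.
Qed.

(** Isolates what the induction can evaluate: with [A] of the form g^-1 (x) Y and [B] an iterated
    derivative of f, the first sum is a Laplacian and the sums with differences of [B] are of lower
    order. *)
Lemma sum_permute_difference r (s t : 'S_r) (A X B : r.-tuple 'I_n -> F) :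
  (s^-1 = s)%g -> (t^-1 = t)%g ->
  \sum_I (A (permute s I) - X (permute t I)) * B I =
  \sum_I A I * B I - \sum_I A I * (B I - B (permute s I))
  + \sum_I X I * (B I - B (permute t I)) - \sum_I X I * B I.
Proof.
move=> sV tV.
under [LHS]eq_bigr do rewrite mulrBl.
rewrite sumrB !sum_permute_involution //.
under [X in _ - X + _ - _]eq_bigr do rewrite mulrBr.
under [X in _ + X - _]eq_bigr do rewrite mulrBr.
rewrite !sumrB.
by move: (\sum_I _) (\sum_I _) (\sum_I _) (\sum_I _) => p q u v; ring.
Qed.

Variables (g H : 'I_n -> 'I_n -> F).
Hypothesis HgE : forall k l, \sum_a H k a * g a l = (k == l)%:R.

(** The matrix of w |-> g(e_b, w) e_a - g(e_a, w) e_b. These skew endomorphisms span so(g), and at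
    constant curvature K the operator R(e_a, e_b) is K times this one. *)
Definition rotation (a b k l : 'I_n) : F := (k == a)%:R * g b l - (k == b)%:R * g a l.

Lemma sum_delta (I : finType) (i : I) (f : I -> F) :
  \sum_j (i == j)%:R * f j = f i.
Proof.
rewrite (bigD1 i) //= eqxx mul1r big1 ?addr0 // => j ji.
by rewrite eq_sym (negbTE ji) mul0r.
Qed.

(* Contract [slot (rotation a b) X (b :: J) = 0] over [b] and raise [a]. *)
Lemma rotation_invariant r (X : r.+1.-tuple 'I_n -> F) :
  (forall a b I, slot (rotation a b) X I = 0) ->
  forall k (J : r.-tuple 'I_n),
  (n%:R - 1) * X [tuple of k :: J] =
  \sum_(s < r) (H k (tnth J s) *
      (\sum_b \sum_l g b l * X [tuple of b :: replace_at J s l])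
    - X [tuple of tnth J s :: replace_at J s k]).
Proof.
move=> inv k J.
have : \sum_a H k a * \sum_b slot (rotation a b) X [tuple of b :: J] = 0.
  by apply: big1 => a _; rewrite big1 ?mulr0.
under eq_bigr => a _ do under eq_bigr => b _ do rewrite slot_cons.
under eq_bigr => a _ do rewrite big_split mulrDr.
rewrite big_split /=.
(* Slot 0: the trace of the identity gives [n] and the other delta gives 1, so the sum over [b] is
   (1 - n) g_al; raising [a] turns g_al into a delta. *)
have -> : \sum_a H k a * (\sum_b \sum_l rotation a b b l * X [tuple of l :: J]) =
   - ((n%:R - 1) * X [tuple of k :: J]).
  have -> : - ((n%:R - 1) * X [tuple of k :: J]) =
      \sum_l (k == l)%:R * ((1 - n%:R) * X [tuple of l :: J]).
    by rewrite sum_delta -mulNr opprB.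
  transitivity (\sum_a H k a * \sum_l (1 - n%:R) * (g a l * X [tuple of l :: J])).
    apply: eq_bigr => a _; congr (_ * _); rewrite exchange_big /=.
    apply: eq_bigr => l _; rewrite -big_distrl /= mulrA; congr (_ * _).
    rewrite /rotation sumrB; under eq_bigr do rewrite eq_sym.
    rewrite (sum_delta a (fun b => g b l)).
    under [X in _ - X]eq_bigr do rewrite eqxx mul1r.
    rewrite sumr_const card_ord -mulr_natl.
    ring.
  under eq_bigr do rewrite big_distrr.
  rewrite exchange_big; apply: eq_bigr => l _ /=.
  rewrite -HgE big_distrl; apply: eq_bigr => a _ /=; ring.
move/eqP; rewrite addrC subr_eq0 => /eqP <-.
rewrite /slot.
under eq_bigr => a _ do rewrite exchange_big big_distrr.
rewrite exchange_big; apply: eq_bigr => s _.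
(* In any other slot [s], the first term of [rotation] contracts slot 0 with [s], and the second
   exchanges them once [a] is raised. *)
transitivity (\sum_a H k a * ((a == tnth J s)%:R *
    (\sum_b \sum_l g b l * X [tuple of b :: replace_at J s l])
   - \sum_l g a l * X [tuple of tnth J s :: replace_at J s l])).
  apply: eq_bigr => a _; congr (_ * _).
  have -> : \sum_l g a l * X [tuple of tnth J s :: replace_at J s l] =
      \sum_b (tnth J s == b)%:R * \sum_l g a l * X [tuple of b :: replace_at J s l].
    by rewrite sum_delta.
  rewrite big_distrr -sumrB; apply: eq_bigr => b _ /=.
  rewrite !big_distrr -sumrB; apply: eq_bigr => l _ /=.
  by rewrite /rotation [a == _]eq_sym; ring.
rewrite -[RHS]/(H k (tnth J s) *
    (\sum_b \sum_l g b l * X [tuple of b :: replace_at J s l])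
  - X [tuple of tnth J s :: replace_at J s k]).
under eq_bigr => a _ do rewrite mulrBr.
rewrite sumrB; congr (_ - _).
  under eq_bigr do rewrite mulrCA eq_sym.
  by rewrite (sum_delta _ (fun a => H k a * _)).
under eq_bigr do rewrite big_distrr.
rewrite exchange_big /=.
rewrite -[RHS](sum_delta k (fun l => X [tuple of tnth J s :: replace_at J s l])).
apply: eq_bigr => l _; rewrite -HgE big_distrl; apply: eq_bigr => a _ /=.
by rewrite mulrA.
Qed.

Lemma rotation_invariant1 (X : 1.-tuple 'I_n -> F) :
  (forall a b I, slot (rotation a b) X I = 0) ->
  forall I, (n%:R - 1) * X I = 0.
Proof.
by move=> inv I; case/tupleP: I => k J; rewrite rotation_invariant // big_ord0.
Qed.

(** Form suited to parallel tensors: [lift0_perm (tperm ord0 s)] exchanges slots 1 and s + 1, so the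
    contraction and the insertion of [H] both happen in the first two slots. *)
Lemma rotation_invariant2 r (X : r.+2.-tuple 'I_n -> F) :
  (forall a b I, slot (rotation a b) X I = 0) ->
  forall I, (n%:R - 1) * X I =
  \sum_(s < r.+1) (
    tens2 H (contr2 g (fun K => X (permute (lift0_perm (tperm ord0 s)) K)))
      (permute (lift0_perm (tperm ord0 s)) I)
    - X (permute (tperm ord0 (lift ord0 s)) I)).
Proof.
move=> inv I; case/tupleP: I => k J; rewrite rotation_invariant //.
apply: eq_bigr => s _; rewrite permute_tperm0; congr (_ - _).
rewrite permute_lift0.
(* [c] is the entry of [J] in slot [s], and [K] holds the entries left after exchanging slots 0 and
   [s] of [J]. *)
case E : _ / (tupleP (permute (tperm ord0 s) J)) => [c K].
have rE l : replace_at J s l = permute (tperm ord0 s) [tuple of l :: K].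
  apply: eq_from_tnth => t; rewrite !tnth_mktuple; have [->|ts] := eqVneq t s.
    by rewrite tpermR tnth0.
  have JE : J = permute (tperm ord0 s) [tuple of c :: K].
    by rewrite -E permuteM tperm2 permute1.
  rewrite JE tnth_mktuple.
  have [u ->|E0] := unliftP ord0 (tperm ord0 s t); first by rewrite !tnthS.
  by move: ts; rewrite -(tpermK ord0 s t) E0 tpermL eqxx.
have cE : tnth J s = c.
  have := congr1 (fun T : r.+1.-tuple _ => tnth T ord0) E.
  by rewrite tnth0 tnth_mktuple tpermL.
rewrite tens2_cons cE; congr (_ * _).
apply: eq_bigr => b _; apply: eq_bigr => l _.
by rewrite rE permute_lift0.
Qed.

End OrthogonalInvariance.

(** * Connections and the Ricci identity *)

Section Connection.
Context {R : realType} {n : nat}.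
Local Open Scope complex_scope.

Definition connection := 'I_n -> 'rV[R]_n -> 'I_n -> 'I_n -> R.
Definition tfield r := 'rV[R]_n -> r.-tuple 'I_n -> R[i].

Implicit Types (G : connection) (x : 'rV[R]_n).

(** One operator for both variances: [nabla_contra] is [nab] of the Levi-Civita matrices, and
    [nabla_cov] is [nab] of their dual. The direction [i] is a parameter and not a tensor slot. *)
Definition nab G (i : 'I_n) r (T : tfield r) : tfield r := fun x I =>
  cpartial i (fun y => T y I) x + slot (fun k l => (G i x k l)%:C) (T x) I.

Definition dual_connection G : connection := fun i x k l => - G i x l k.

Definition connection_curvature G (a b : 'I_n) x (k l : 'I_n) : R :=
  partial a (fun y => G b y k l) x - partial b (fun y => G a y k l) x
  + \sum_m (G a x k m * G b x m l - G b x k m * G a x m l).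

Variable O : set 'rV[R]_n.
Hypothesis oO : open O.

Definition tsmooth r (T : tfield r) := forall I, csmooth_on O (fun x => T x I).
Definition msmooth (A : 'rV[R]_n -> 'I_n -> 'I_n -> R) :=
  forall k l, smooth_on O (fun x => A x k l).

Lemma csmooth_on_slot (A : 'rV[R]_n -> 'I_n -> 'I_n -> R) r (T : tfield r) :
  msmooth A -> tsmooth T -> tsmooth (fun x => slot (fun k l => (A x k l)%:C) (T x)).
Proof.
move=> sA sT I; apply: csmooth_on_sum => // s; apply: csmooth_on_sum => // l.
by apply: csmooth_onM => //; apply: csmooth_on_real => //; apply: sA.
Qed.

Lemma cpartial_slot (A : 'rV[R]_n -> 'I_n -> 'I_n -> R) r (T : tfield r) i x I :
  msmooth A -> tsmooth T -> O x ->
  cpartial i (fun y => slot (fun k l => (A y k l)%:C) (T y) I) x =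
  slot (fun k l => (partial i (fun y => A y k l) x)%:C) (T x) I
  + slot (fun k l => (A x k l)%:C) (fun J => cpartial i (fun y => T y J) x) I.
Proof.
move=> sA sT Ox.
have sM s l : csmooth_on O (fun x => (A x (tnth I s) l)%:C * T x (replace_at I s l)).
  by apply: csmooth_onM => //; apply: csmooth_on_real => //; apply: sA.
rewrite /slot (cpartial_sum oO) //; last by move=> s; apply: csmooth_on_sum.
rewrite -big_split; apply: eq_bigr => s _.
rewrite (cpartial_sum oO) // -big_split; apply: eq_bigr => l _ /=.
rewrite (@cpartialM _ _ O) //; last by apply: csmooth_on_real => //; apply: sA.
by rewrite cpartial_real.
Qed.

Lemma tsmooth_nab G r (T : tfield r) i : msmooth (G i) -> tsmooth T ->
  tsmooth (nab G i T).
Proof.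
move=> sG sT I; apply: csmooth_onD => //; first exact: csmooth_on_partial.
exact: csmooth_on_slot.
Qed.

(** Coordinate fields commute and the directions [a], [b] are not slots, so neither a bracket nor a
    torsion term occurs. Second partial derivatives cancel, the terms of first order in [T] are
    symmetric in [a] and [b], and [slot_commutator] gives the quadratic part of the curvature. *)
Lemma ricci_identity G r (T : tfield r) a b x I :
  (forall i, msmooth (G i)) -> tsmooth T -> O x ->
  nab G a (nab G b T) x I - nab G b (nab G a T) x I =
  slot (fun k l => (connection_curvature G a b x k l)%:C) (T x) I.
Proof.
move=> sG sT Ox.
have E c d : nab G c (nab G d T) x I =
    cpartial c (cpartial d (fun y => T y I)) x
    + slot (fun k l => (partial c (fun y => G d y k l) x)%:C) (T x) I
    + slot (fun k l => (G d x k l)%:C) (fun J => cpartial c (fun y => T y J) x) I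
    + slot (fun k l => (G c x k l)%:C) (fun J => cpartial d (fun y => T y J) x) I
    + slot (fun k l => (G c x k l)%:C) (slot (fun k l => (G d x k l)%:C) (T x)) I.
  rewrite {1}/nab (@cpartialD _ _ O) //; last 2 first.
  - exact: csmooth_on_partial.
  - exact: (csmooth_on_slot (sG d) sT).
  rewrite cpartial_slot // -!addrA; do 3!congr (_ + _).
  by rewrite -slotD.
rewrite !E (cpartialC oO b a (sT I) Ox) //.
have := slot_commutator (fun k l => (G a x k l)%:C) (fun k l => (G b x k l)%:C) (T x) I.
move/eqP; rewrite subr_eq => /eqP ->.
have -> : slot (fun k l => (connection_curvature G a b x k l)%:C) (T x) I =
   slot (fun k l => (partial a (fun y => G b y k l) x)%:C) (T x) I
   - slot (fun k l => (partial b (fun y => G a y k l) x)%:C) (T x) I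
   + slot (fun k l => \sum_m ((G a x k m)%:C * (G b x m l)%:C -
        (G b x k m)%:C * (G a x m l)%:C)) (T x) I.
  rewrite -slotNl -!slotDl; apply: eq_slot => // k l.
  rewrite /connection_curvature rmorphD rmorphB rmorph_sum; congr (_ + _).
  by apply: eq_bigr => m _; rewrite rmorphB !rmorphM.
move: (slot _ _ _) (slot _ _ _) (slot _ _ _) (slot _ _ _) (slot _ _ _) (slot _ _ _).
by move=> p q r' s t u; ring.
Qed.

Lemma nab_permute G i r (s : 'S_r) (T : tfield r) x I :
  nab G i (fun y J => T y (permute s J)) x I = nab G i T x (permute s I).
Proof. by rewrite /nab slot_permute. Qed.

Lemma nabZ G i r (T : tfield r) (c : R[i]) x I : tsmooth T -> O x ->
  nab G i (fun y J => c * T y J) x I = c * nab G i T x I.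
Proof.
move=> sT Ox; rewrite /nab slotZ (@cpartialM _ _ O) //; last exact: csmooth_on_cst.
by rewrite cpartial_cst mul0r add0r mulrDr.
Qed.

Lemma nabB G i r (T T' : tfield r) x I : tsmooth T -> tsmooth T' -> O x ->
  nab G i (fun y J => T y J - T' y J) x I = nab G i T x I - nab G i T' x I.
Proof.
move=> sT sT' Ox; rewrite -mulN1r -(nabZ G i (-1) I sT' Ox) /nab addrACA -slotD.
have sN : tsmooth (fun y J => -1 * T' y J).
  by move=> J; apply: csmooth_onM => //; apply: csmooth_on_cst.
rewrite -(cpartialD i (sT I) (sN I) Ox); congr (_ + _).
  by apply: (cpartial_ext oO i Ox) => y _; rewrite mulN1r.
by apply: eq_slot => // J; rewrite mulN1r.
Qed.

Lemma nab_sum G i r (K : Type) (q : seq K) (T : K -> tfield r) x I :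
  (forall k, tsmooth (T k)) -> O x ->
  nab G i (fun y J => \sum_(k <- q) T k y J) x I = \sum_(k <- q) nab G i (T k) x I.
Proof.
move=> sT Ox; rewrite /nab slot_sum (cpartial_sum oO) //; last by move=> k; apply: sT.
by rewrite big_split.
Qed.

Lemma nab_ext G i r (T T' : tfield r) x I : O x ->
  (forall y J, O y -> T y J = T' y J) -> nab G i T x I = nab G i T' x I.
Proof.
move=> Ox TT; rewrite /nab; congr (_ + _).
  by apply: (cpartial_ext oO) => // y Oy; apply: TT.
by apply: eq_slot => // J; apply: TT.
Qed.

(** The equation of a parallel contravariant 2-tensor for [G]. The inverse metric satisfies it for
    the Levi-Civita connection, the metric for the dual one. *)
Definition parallel2 G (h : 'rV[R]_n -> 'I_n -> 'I_n -> R) :=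
  forall i x a b, O x -> partial i (fun y => h y a b) x
    + (\sum_l G i x a l * h x l b + \sum_l G i x b l * h x a l) = 0.

Lemma csmooth_on_tens2 (h : 'rV[R]_n -> 'I_n -> 'I_n -> R) r (T : tfield r) :
  msmooth h -> tsmooth T -> tsmooth (fun x => tens2 (fun a b => (h x a b)%:C) (T x)).
Proof.
move=> sh sT I; apply: csmooth_onM => //.
by apply: csmooth_on_real => //; apply: sh.
Qed.

Lemma nab_tens2 G h i r (T : tfield r) x I :
  msmooth h -> parallel2 G h -> tsmooth T -> O x ->
  nab G i (fun y => tens2 (fun a b => (h y a b)%:C) (T y)) x I =
  tens2 (fun a b => (h x a b)%:C) (nab G i T x) I.
Proof.
move=> sh ph sT Ox; have [a [b [J ->]]] := tuple_eta2 I.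
rewrite /nab slot_tens2 tens2_cons.
rewrite (@cpartial_ext _ _ _ oO i _ (fun y => (h y a b)%:C * T y J)) //; last first.
  by move=> y _; rewrite tens2_cons.
rewrite (@cpartialM _ _ O) //; last by apply: csmooth_on_real => //; apply: sh.
rewrite cpartial_real addrACA -mulrDl -mulrDr.
have -> : (partial i (fun y => h y a b) x)%:C +
    (\sum_l (G i x a l)%:C * (h x l b)%:C + \sum_l (G i x b l)%:C * (h x a l)%:C) = 0.
  rewrite -[RHS](rmorph0 (real_complex R)) -(ph i x a b Ox) !rmorphD !rmorph_sum.
  by congr (_ + (_ + _)); apply: eq_bigr => l _; rewrite rmorphM.
by rewrite mul0r add0r.
Qed.

Lemma csmooth_on_contr2 (h : 'rV[R]_n -> 'I_n -> 'I_n -> R) r (T : tfield r.+2) :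
  msmooth h -> tsmooth T -> tsmooth (fun x => contr2 (fun a b => (h x a b)%:C) (T x)).
Proof.
move=> sh sT I; apply: csmooth_on_sum => // a; apply: csmooth_on_sum => // b.
by apply: csmooth_onM => //; apply: csmooth_on_real => //; apply: sh.
Qed.

Lemma nab_contr2 G h i r (T : tfield r.+2) x J :
  msmooth h -> parallel2 (dual_connection G) h -> tsmooth T -> O x ->
  nab G i (fun y => contr2 (fun a b => (h y a b)%:C) (T y)) x J =
  contr2 (fun a b => (h x a b)%:C) (nab G i T x) J.
Proof.
move=> sh ph sT Ox.
have sM a b : csmooth_on O (fun y => (h y a b)%:C * T y [tuple of a :: b :: J]).
  by apply: csmooth_onM => //; apply: csmooth_on_real => //; apply: sh.
rewrite /nab slot_contr2 (cpartial_sum oO) //; last first.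
  by move=> a; apply: csmooth_on_sum.
have -> : contr2 (fun a b => (h x a b)%:C) (fun K => cpartial i (fun y => T y K) x
     + slot (fun k l => (G i x k l)%:C) (T x) K) J =
    \sum_a \sum_b (h x a b)%:C * cpartial i (fun y => T y [tuple of a :: b :: J]) x
    + contr2 (fun a b => (h x a b)%:C) (slot (fun k l => (G i x k l)%:C) (T x)) J.
  rewrite -big_split; apply: eq_bigr => a _; rewrite -big_split.
  by apply: eq_bigr => b _; rewrite mulrDr.
rewrite addrCA [RHS]addrC; congr (_ + _); rewrite -sumrB; apply: eq_bigr => a _.
rewrite (cpartial_sum oO) // -sumrB; apply: eq_bigr => b _.
rewrite (@cpartialM _ _ O) //; last by apply: csmooth_on_real => //; apply: sh.
rewrite cpartial_real addrAC -mulrBl.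
have -> : (partial i (fun y => h y a b) x)%:C -
    (\sum_l (G i x l a)%:C * (h x l b)%:C + \sum_l (G i x l b)%:C * (h x a l)%:C) = 0.
  rewrite -[RHS](rmorph0 (real_complex R)) -(ph i x a b Ox) !rmorphD !rmorph_sum.
  rewrite opprD -!sumrN.
  by congr (_ + (_ + _)); apply: eq_bigr => l _; rewrite rmorphM rmorphN mulNr.
by rewrite mul0r add0r.
Qed.

(** By [slot_adjoint] the connection terms of the two factors are opposite, so only the Leibniz rule
    for functions remains. *)
Lemma cpartial_pairing G i r (Y W : tfield r) x :
  tsmooth Y -> tsmooth W -> O x ->
  cpartial i (fun y => \sum_I Y y I * W y I) x =
  \sum_I (nab G i Y x I * W x I + Y x I * nab (dual_connection G) i W x I).
Proof.
move=> sY sW Ox; rewrite (cpartial_sum oO) //; last first.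
  by move=> I; apply: csmooth_onM.
under [RHS]eq_bigr do rewrite mulrDl mulrDr addrACA.
rewrite big_split /= -[LHS]addr0; congr (_ + _).
  by apply: eq_bigr => I _; rewrite (@cpartialM _ _ O).
rewrite big_split /= slot_adjoint -big_split /= big1 // => I _.
rewrite -mulrDr -slotDl; apply/eqP; rewrite mulf_eq0; apply/orP; right; apply/eqP.
rewrite /slot big1 // => s _; rewrite big1 // => l _.
by rewrite rmorphN addrN mul0r.
Qed.

End Connection.

(** * Levi-Civita connection and curvature *)

Section AlgebraicCurvature.
Context {R : realFieldType} {n : nat}.

Definition qform (t : 'I_n -> 'I_n -> 'I_n -> 'I_n -> R) (u v w z : 'rV[R]_n) : R :=
  \sum_i \sum_j \sum_k \sum_l u 0 i * v 0 j * w 0 k * z 0 l * t l k i j.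

Lemma sum_delta_mx (m : nat) (i : 'I_m) (f : 'I_m -> R) :
  \sum_j (delta_mx 0 i : 'rV[R]_m) 0 j * f j = f i.
Proof.
rewrite (bigD1 i) //= mxE !eqxx mul1r big1 ?addr0 // => j ji.
by rewrite mxE (negbTE ji) andbF mul0r.
Qed.

Lemma qform_delta t i j k l :
  qform t (delta_mx 0 i) (delta_mx 0 j) (delta_mx 0 k) (delta_mx 0 l) = t l k i j.
Proof.
rewrite /qform.
under eq_bigr => a _ do under eq_bigr => b _ do under eq_bigr => c _ do
  under eq_bigr => d _ do rewrite -!mulrA.
under eq_bigr => a _ do under eq_bigr => b _ do under eq_bigr => c _ do
  rewrite -!big_distrr sum_delta_mx /=.
under eq_bigr => a _ do under eq_bigr => b _ do rewrite -!big_distrr sum_delta_mx /=.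
under eq_bigr => a _ do rewrite -!big_distrr sum_delta_mx /=.
by rewrite sum_delta_mx.
Qed.

Lemma qformD1 t u u' v w z : qform t (u + u') v w z = qform t u v w z + qform t u' v w z.
Proof.
by rewrite /qform; do 4!(rewrite -big_split; apply: eq_bigr => ? _); rewrite /= mxE; ring.
Qed.

Lemma qformD2 t u v v' w z : qform t u (v + v') w z = qform t u v w z + qform t u v' w z.
Proof.
by rewrite /qform; do 4!(rewrite -big_split; apply: eq_bigr => ? _); rewrite /= mxE; ring.
Qed.

Lemma qformD3 t u v w w' z : qform t u v (w + w') z = qform t u v w z + qform t u v w' z.
Proof.
by rewrite /qform; do 4!(rewrite -big_split; apply: eq_bigr => ? _); rewrite /= mxE; ring.
Qed.

Lemma qformD4 t u v w z z' : qform t u v w (z + z') = qform t u v w z + qform t u v w z'.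
Proof.
by rewrite /qform; do 4!(rewrite -big_split; apply: eq_bigr => ? _); rewrite /= mxE; ring.
Qed.

(** Polarization. The biquadratic form <R(u, v) v, u> determines a tensor with the symmetries of a
    curvature tensor. *)
Lemma curvature_tensor_eq0 (t : 'I_n -> 'I_n -> 'I_n -> 'I_n -> R) :
  (forall l k i j, t l k i j = - t l k j i) ->
  (forall l k i j, t l k i j = - t k l i j) ->
  (forall l k i j, t l k i j + t l i j k + t l j k i = 0) ->
  (forall u v, qform t u v v u = 0) ->
  forall l k i j, t l k i j = 0.
Proof.
move=> t12 t34 bianchi q0.
(* The classical pair symmetry, from four instances of the Bianchi identity and the two skew
   symmetries. *)
have pair l k i j : t l k i j = t i j l k.
  have := bianchi l k i j; have := bianchi k l i j.
  have := bianchi i l k j; have := bianchi j l k i.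
  have := t12 l k i j; have := t34 l k i j; have := t12 l i j k; have := t12 l j k i.
  have := t34 l i j k; have := t34 l j k i; have := t12 k l i j.
  have := t12 k i j l; have := t34 k i j l; have := t12 k j l i; have := t34 k j l i.
  have := t12 i l k j; have := t34 i l k j; have := t12 i k j l; have := t34 i k j l.
  have := t12 i j l k; have := t34 i j l k; have := t12 j l k i; have := t34 j l k i.
  have := t12 j k i l; have := t34 j k i l; have := t12 j i l k; have := t34 j i l k.
  lra.
(* Coefficient of the mixed monomial, obtained by polarizing in [u] at e_i + e_l and in [v] at e_j +
   e_k. *)
have E1 l j k i : t l k i j + t l j i k + t i k l j + t i j l k = 0.
  have qd i1 j1 k1 l1 := qform_delta t i1 j1 k1 l1.
  have := q0 (delta_mx 0 i + delta_mx 0 l) (delta_mx 0 j + delta_mx 0 k).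
  have := q0 (delta_mx 0 i + delta_mx 0 l) (delta_mx 0 j).
  have := q0 (delta_mx 0 i + delta_mx 0 l) (delta_mx 0 k).
  have := q0 (delta_mx 0 i) (delta_mx 0 j + delta_mx 0 k).
  have := q0 (delta_mx 0 l) (delta_mx 0 j + delta_mx 0 k).
  have := q0 (delta_mx 0 i) (delta_mx 0 j); have := q0 (delta_mx 0 i) (delta_mx 0 k).
  have := q0 (delta_mx 0 l) (delta_mx 0 j); have := q0 (delta_mx 0 l) (delta_mx 0 k).
  rewrite !(qformD1, qformD2, qformD3, qformD4) !qd.
  lra.
have E2 l j k i : t l k i j = - t l j i k.
  have := E1 l j k i; have := pair i k l j; have := pair i j l k.
  have := t12 l j k i; have := t34 l j k i; have := t12 j l k i; have := t34 j l i k.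
  have := t12 l k j i; have := t34 l k j i; have := t12 k l j i; have := t34 k l i j.
  have := t12 l j i k; have := t12 l k i j.
  lra.
(* By [E2] and [t12] the tensor is alternating in its last three indices, so the three cyclic terms
   of the Bianchi identity are equal and their sum is three times one of them. *)
move=> l k i j; have := bianchi l k i j.
have := E2 l j k i; have := E2 l j i k; have := E2 l i j k; have := E2 l k i j.
have := E2 l i k j; have := E2 l k j i.
have := t12 l i j k; have := t12 l j k i; have := t12 l k i j.
lra.
Qed.

End AlgebraicCurvature.

(** * Metric, connection and curvature in a single chart *)

Section LocalGeometry.
Context {R : realType} {n : nat} (M : riemannian_manifold R n) (c : atlas M).
Implicit Types x u v w : 'rV[R]_n.
Let O := img c.

Lemma img_open : open O. Proof. exact: cimg_open. Qed.
Let oO : open O := img_open.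

Definition levi_civita : connection := fun i x k l => christoffel c x k i l.

Lemma metricC x i j : O x -> metric c x i j = metric c x j i.
Proof. by move=> Ox; rewrite -[in LHS](Defs.metric_sym Ox) mxE. Qed.

Lemma metric_unit x : O x -> metric c x \in unitmx.
Proof.
move=> Ox; rewrite -row_free_unit -kermx_eq0; apply/rowV0P => v /sub_kermxP vg.
apply/eqP/negPn/negP => v0.
by have := metric_posdef Ox v0; rewrite vg mul0mx mxE ltxx.
Qed.

Definition cometric x : 'M[R]_n := invmx (metric c x).

Lemma cometric_metric x k l : O x ->
  \sum_a cometric x k a * metric c x a l = (k == l)%:R.
Proof.
move=> Ox; have := congr1 (fun A : 'M[R]_n => A k l) (mulVmx (metric_unit Ox)).
by rewrite !mxE.
Qed.

Lemma metric_cometric x k l : O x ->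
  \sum_a metric c x k a * cometric x a l = (k == l)%:R.
Proof.
move=> Ox; have := congr1 (fun A : 'M[R]_n => A k l) (mulmxV (metric_unit Ox)).
by rewrite !mxE.
Qed.

Lemma msmooth_metric : msmooth O (fun x k l => metric c x k l).
Proof. by move=> k l; apply: metric_smooth. Qed.

Lemma msmooth_cometric : msmooth O (fun x k l => cometric x k l).
Proof.
move=> k l; apply: (smooth_on_invmx oO) => [i j|x Ox]; first exact: metric_smooth.
exact: metric_unit.
Qed.

Lemma smooth_christoffel k i j : smooth_on O (fun x => christoffel c x k i j).
Proof.
apply: (smooth_onM oO); first exact: smooth_on_cst.
apply: smooth_on_sum => // l; apply: (smooth_onM oO); first exact: msmooth_cometric.
apply: (smooth_onB oO); first apply: (smooth_onD oO).
all: exact/smooth_on_partial/metric_smooth.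
Qed.

Lemma msmooth_levi_civita i : msmooth O (levi_civita i).
Proof. by move=> k l; apply: smooth_christoffel. Qed.

Lemma msmooth_dual (G : connection) i : msmooth O (G i) -> msmooth O (dual_connection G i).
Proof. by move=> sG k l; apply: (smooth_onN oO (sG l k)). Qed.

Lemma partial_metricC i a b x : O x ->
  partial i (fun y => metric c y a b) x = partial i (fun y => metric c y b a) x.
Proof. by move=> Ox; apply: (partial_ext _ oO Ox) => y; apply: metricC. Qed.

Lemma christoffelC k i j x : O x -> christoffel c x k i j = christoffel c x k j i.
Proof.
move=> Ox; congr (_ * _); apply: eq_bigr => l _; congr (_ * _).
by rewrite (partial_metricC l i j Ox) [X in X - _]addrC.
Qed.

(** Lowering the upper index cancels the inverse metric and leaves the Christoffel symbols of the
    first kind. *)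
Lemma metric_christoffel x i j k : O x ->
  \sum_l metric c x k l * christoffel c x l i j =
  2^-1 * (partial i (fun y => metric c y j k) x + partial j (fun y => metric c y i k) x
          - partial k (fun y => metric c y i j) x).
Proof.
move=> Ox; rewrite /christoffel.
under eq_bigr do rewrite mulrCA.
rewrite -big_distrr; congr (_ * _) => /=.
under eq_bigr do rewrite big_distrr.
rewrite exchange_big /=.
under eq_bigr do under eq_bigr do rewrite mulrA.
under eq_bigr => l _ do rewrite -big_distrl (metric_cometric k l Ox).
by rewrite (sum_delta k (fun l => _ + _ - _)).
Qed.

(** In the sum of the two first-kind symbols the derivatives along [a] and [b] cancel, and the two
    halves of the derivative along [i] add up. *)
Lemma metric_parallel :
  parallel2 O (dual_connection levi_civita) (fun x a b => metric c x a b).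
Proof.
move=> i x a b Ox.
have E p q : \sum_l dual_connection levi_civita i x p l * metric c x q l =
    - (\sum_l metric c x q l * christoffel c x l i p).
  by rewrite -sumrN; apply: eq_bigr => l _; rewrite mulNr mulrC.
have -> : \sum_l dual_connection levi_civita i x a l * metric c x l b =
   \sum_l dual_connection levi_civita i x a l * metric c x b l.
  by apply: eq_bigr => l _; rewrite (metricC l b Ox).
rewrite !E !metric_christoffel // (partial_metricC i b a Ox).
rewrite (partial_metricC a i b Ox) (partial_metricC b i a Ox).
by field.
Qed.

(** Differentiate g^-1 g = 1, substitute [metric_parallel] for the derivative of g, and multiply by
    g^-1 on the right. *)
Lemma cometric_parallel : parallel2 O levi_civita (fun x a b => cometric x a b).
Proof.
move=> i x a b Ox.
pose dH := \matrix_(p, q) partial i (fun y => cometric y p q) x.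
pose dg := \matrix_(p, q) partial i (fun y => metric c y p q) x.
pose P := \matrix_(p, q) christoffel c x q i p.
have dgE : dg = P *m metric c x + metric c x *m P^T.
  apply/matrixP => p q; rewrite !mxE; have := metric_parallel i p q Ox.
  have -> : \sum_l dual_connection levi_civita i x p l * metric c x l q =
      - \sum_l P p l * metric c x l q.
    by rewrite -sumrN; apply: eq_bigr => l _; rewrite !mxE mulNr.
  have -> : \sum_l dual_connection levi_civita i x q l * metric c x p l =
      - \sum_l metric c x p l * P^T l q.
    by rewrite -sumrN; apply: eq_bigr => l _; rewrite !mxE mulNr mulrC.
  by rewrite -opprD => /eqP; rewrite subr_eq0 => /eqP.
have dE : dH *m metric c x + cometric x *m dg = 0.
  apply/matrixP => p q; rewrite !mxE -big_split /=.
  have s1 l : smooth_on O (fun y => cometric y p l * metric c y l q).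
    by apply: (smooth_onM oO); [exact: msmooth_cometric|exact: msmooth_metric].
  transitivity (partial i (fun y => \sum_l cometric y p l * metric c y l q) x); last first.
    transitivity (partial i (fun=> (p == q)%:R : R) x); last exact: derive_cst.
    by apply: (partial_ext _ oO Ox) => y; apply: cometric_metric.
  rewrite (partial_sum oO) //; apply: eq_bigr => l _; rewrite !mxE.
  by rewrite (partialM i (msmooth_cometric p l) (msmooth_metric l q) Ox).
have gU := metric_unit Ox.
have : dH + (cometric x *m P + P^T *m cometric x) = 0.
  transitivity ((dH *m metric c x + cometric x *m dg) *m cometric x); last first.
    by rewrite dE mul0mx.
  rewrite dgE mulmxDl mulmxK // mulmxDr mulmxDl (mulmxA (cometric x) P) mulmxK //.
  by rewrite (mulmxA (cometric x) (metric c x)) mulVmx // mul1mx.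
move/matrixP/(_ a b); rewrite !mxE => E; apply: etrans E; congr (_ + _).
by rewrite addrC; congr (_ + _); apply: eq_bigr => l _; rewrite !mxE // mulrC.
Qed.

Lemma riemannE x a b k l :
  connection_curvature levi_civita a b x k l = riemann c x k l a b.
Proof. by []. Qed.

Lemma dual_curvatureE x a b k l : O x ->
  connection_curvature (dual_connection levi_civita) a b x k l = - riemann c x l k a b.
Proof.
move=> Ox; rewrite /connection_curvature /riemann /dual_connection /levi_civita.
have pN i p q r : partial i (fun y => - christoffel c y p q r) x =
    - partial i (fun y => christoffel c y p q r) x.
  exact: (deriveN (smooth_on_derivable (smooth_christoffel p q r) Ox)).
rewrite !pN; set S1 := \sum_m _; set S2 := \sum_m _.
have -> : S1 = - S2.
  rewrite /S1 /S2 -sumrN; apply: eq_bigr => m _; ring.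
move: (partial _ _ _) (partial _ _ _) => p q; ring.
Qed.

Definition lowered_riemann x (l k a b : 'I_n) : R :=
  \sum_m metric c x l m * riemann c x m k a b.

Lemma riemann_antisym x l k a b : riemann c x l k a b = - riemann c x l k b a.
Proof.
rewrite /riemann opprD opprB; congr (_ + _); rewrite -sumrN.
by apply: eq_bigr => m _; rewrite opprB.
Qed.

Lemma riemann_bianchi x l k i j : O x ->
  riemann c x l k i j + riemann c x l i j k + riemann c x l j k i = 0.
Proof.
move=> Ox; rewrite /riemann.
have pC p q r : partial p (fun y => christoffel c y l q r) x =
    partial p (fun y => christoffel c y l r q) x.
  by apply: (partial_ext _ oO Ox) => y; apply: christoffelC.
rewrite (pC i k j) (pC j i k) (pC k i j) -!addrA.
set S1 := \sum_m _; set S2 := \sum_m _; set S3 := \sum_m _.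
have S0 : S1 + S2 + S3 = 0.
  rewrite /S1 /S2 /S3 -!big_split big1 // => m _ /=.
  rewrite (christoffelC m k j Ox) (christoffelC m i k Ox) (christoffelC m j i Ox).
  ring.
have -> : S1 = - S2 - S3.
  by move: S0; move: S1 S2 S3 => p q r E; rewrite -[RHS]add0r -E; ring.
move: (partial _ _ _) (partial _ _ _) (partial _ _ _) => p q r; ring.
Qed.

(** The curvature annihilates the metric because the metric is parallel. The metric is written as g
    (x) 1, with 1 of degree 0, so that [nab_tens2] and [slot_tens2] apply. *)
Lemma lowered_riemann_skew x l k a b : O x ->
  lowered_riemann x l k a b = - lowered_riemann x k l a b.
Proof.
move=> Ox.
pose T : tfield 2 := fun y => tens2 (fun p q => (metric c y p q)%:C%C) (fun=> 1).
have sc1 : tsmooth O (fun (_ : 'rV[R]_n) (_ : 0.-tuple 'I_n) => 1 : R[i]).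
  by move=> I; apply: csmooth_on_cst.
have sT : tsmooth O T by apply: csmooth_on_tens2 => //; exact: msmooth_metric.
have dT i y J : O y -> nab (dual_connection levi_civita) i T y J = 0.
  move=> Oy; rewrite (nab_tens2 oO _ _ msmooth_metric metric_parallel sc1 Oy).
  by rewrite /tens2 /nab cpartial_cst slot0 addr0 mulr0.
have ddT i j y J : O y -> nab (dual_connection levi_civita) i
    (nab (dual_connection levi_civita) j T) y J = 0.
  move=> Oy; rewrite (nab_ext oO (T' := fun _ _ => 0) _ _ _ Oy); last exact: dT.
  rewrite /nab cpartial_cst add0r /slot big1 // => s _.
  by rewrite big1 // => p _; rewrite mulr0.
have := ricci_identity oO a b [tuple l; k]
  (fun i => msmooth_dual (msmooth_levi_civita i)) sT Ox.
rewrite !ddT // subr0 => /esym.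
rewrite (slot_tens2 _ _ _ l k [tuple]) slot0 mulr0 addr0 mulr1.
have -> : \sum_m (connection_curvature (dual_connection levi_civita) a b x l m)%:C%C *
    (metric c x m k)%:C%C = - (lowered_riemann x k l a b)%:C%C.
  rewrite rmorph_sum -sumrN; apply: eq_bigr => m _ /=.
  by rewrite dual_curvatureE // rmorphN rmorphM mulNr mulrC (metricC m k Ox).
have -> : \sum_m (connection_curvature (dual_connection levi_civita) a b x k m)%:C%C *
    (metric c x l m)%:C%C = - (lowered_riemann x l k a b)%:C%C.
  rewrite rmorph_sum -sumrN; apply: eq_bigr => m _ /=.
  by rewrite dual_curvatureE // rmorphN rmorphM mulNr mulrC.
rewrite -!rmorphN -rmorphD => /(@complexI R _ 0) /eqP.
by rewrite addr_eq0 opprK => /eqP ->.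
Qed.

End LocalGeometry.

(** * Constant sectional curvature *)

Section ConstantCurvature.
Context {R : realType} {n : nat} (M : riemannian_manifold R n) (c : atlas M).
Implicit Types x u v w z : 'rV[R]_n.

Lemma innerE x u v :
  inner c x u v = \sum_i \sum_j u 0 i * metric c x i j * v 0 j.
Proof.
rewrite /inner mxE exchange_big /=; apply: eq_bigr => j _; rewrite !mxE.
by rewrite big_distrl.
Qed.

Lemma innerDl x u u' v : inner c x (u + u') v = inner c x u v + inner c x u' v.
Proof. by rewrite /inner !mulmxDl mxE. Qed.

Lemma innerZl x a u v : inner c x (a *: u) v = a * inner c x u v.
Proof. by rewrite /inner -!scalemxAl mxE. Qed.

Lemma innerC x u v : img c x -> inner c x u v = inner c x v u.
Proof.
move=> Ox; rewrite !innerE exchange_big; apply: eq_bigr => i _; apply: eq_bigr => j _.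
by rewrite (metricC _ _ Ox); ring.
Qed.

Lemma innerDr x u v v' : img c x -> inner c x u (v + v') = inner c x u v + inner c x u v'.
Proof. by move=> Ox; rewrite !(innerC u) // innerDl. Qed.

Lemma innerZr x a u v : img c x -> inner c x u (a *: v) = a * inner c x u v.
Proof. by move=> Ox; rewrite !(innerC u) // innerZl. Qed.

Lemma col_mx2_comb (a b : R) u v :
  row_mx a%:M b%:M *m col_mx u v = a *: u + b *: v :> 'rV[R]_n.
Proof. by rewrite mul_row_col !mul_scalar_mx. Qed.

Lemma gram_det_neq0 x u v : img c x -> row_free (col_mx u v) ->
  inner c x u u * inner c x v v - inner c x u v ^+ 2 != 0.
Proof.
move=> Ox uv.
have indep (a b : R) : a *: u + b *: v = 0 -> a = 0 /\ b = 0.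
  rewrite -col_mx2_comb => /eqP; rewrite mulmx_free_eq0 // => /eqP E.
  split.
    by have := congr1 (fun A => lsubmx A 0 0) E; rewrite row_mxKl !mxE.
  by have := congr1 (fun A => rsubmx A 0 0) E; rewrite row_mxKr !mxE.
have v0 : v != 0.
  apply/negP => /eqP v0; have [|_ /eqP] := indep 0 1; rewrite ?oner_eq0 //.
  by rewrite scale0r v0 scaler0 addr0.
have vv : 0 < inner c x v v by apply: metric_posdef.
(* The squared norm of this vector is <v, v> times the Gram determinant. *)
have w0 : inner c x v v *: u - inner c x u v *: v != 0.
  apply/negP => /eqP; rewrite -scaleNr => /indep[/eqP].
  by rewrite gt_eqF.
have := metric_posdef Ox w0; rewrite -/(inner c x _ _) -scaleNr.
rewrite innerDl !innerDr // !innerZl !innerZr // (innerC v u Ox).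
move: (inner _ _ _ _) (inner _ _ _ _) (inner _ _ _ _) vv => p q r vv H.
apply/negP => /eqP E.
have : r * (q * r - p ^+ 2) = 0 by rewrite E mulr0.
move: H; lra.
Qed.

Lemma qform_prod (A B : 'I_n -> 'I_n -> R) u v w z :
  qform (fun l k i j => A l i * B j k) u v w z =
  (\sum_i \sum_l u 0 i * A l i * z 0 l) * (\sum_j \sum_k v 0 j * B j k * w 0 k).
Proof.
rewrite /qform big_distrl; apply: eq_bigr => i _; rewrite /= mulrC big_distrl.
apply: eq_bigr => j _; rewrite /= big_distrl; apply: eq_bigr => k _.
rewrite big_distrr; apply: eq_bigr => l _ /=; ring.
Qed.

Lemma eq_qform (t t' : 'I_n -> 'I_n -> 'I_n -> 'I_n -> R) u v w z :
  (forall l k i j, t l k i j = t' l k i j) -> qform t u v w z = qform t' u v w z.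
Proof. by move=> E; rewrite /qform; do 4!(apply: eq_bigr => ? _); rewrite E. Qed.

Lemma qform_lin (a : R) (t t' : 'I_n -> 'I_n -> 'I_n -> 'I_n -> R) u v w z :
  qform (fun l k i j => t l k i j + a * t' l k i j) u v w z =
  qform t u v w z + a * qform t' u v w z.
Proof.
rewrite /qform big_distrr -big_split; apply: eq_bigr => i _ /=.
rewrite big_distrr -big_split; apply: eq_bigr => j _ /=.
rewrite big_distrr -big_split; apply: eq_bigr => k _ /=.
rewrite big_distrr -big_split; apply: eq_bigr => l _ /=.
ring.
Qed.

Lemma qformZ1 (a : R) (t : 'I_n -> 'I_n -> 'I_n -> 'I_n -> R) u v w z :
  qform t (a *: u) v w z = a * qform t u v w z.
Proof.
by rewrite /qform; do 4!(rewrite big_distrr; apply: eq_bigr => ? _ /=); rewrite !mxE; ring.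
Qed.

Lemma qformZ2 (a : R) (t : 'I_n -> 'I_n -> 'I_n -> 'I_n -> R) u v w z :
  qform t u (a *: v) w z = a * qform t u v w z.
Proof.
by rewrite /qform; do 4!(rewrite big_distrr; apply: eq_bigr => ? _ /=); rewrite !mxE; ring.
Qed.

Lemma qform_skew (t : 'I_n -> 'I_n -> 'I_n -> 'I_n -> R) v w z :
  (forall l k i j, t l k i j = - t l k j i) -> qform t v v w z = 0.
Proof.
move=> t12; have E : qform t v v w z = - qform t v v w z.
  rewrite {1}/qform exchange_big -sumrN; apply: eq_bigr => j _; rewrite -sumrN.
  apply: eq_bigr => i _; rewrite -sumrN; apply: eq_bigr => k _; rewrite -sumrN.
  by apply: eq_bigr => l _; rewrite t12; ring.
by move: E; move: (qform _ _ _ _ _) => q; lra.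
Qed.

Lemma inner_curvature x u v w z : img c x ->
  inner c x (curvature c x u v w) z = qform (lowered_riemann c x) u v w z.
Proof.
move=> Ox; rewrite innerE /qform.
under eq_bigr => m _ do under eq_bigr => l _ do
  rewrite mxE -mulrA big_distrl /=.
under eq_bigr => m _ do rewrite exchange_big /=.
rewrite exchange_big; apply: eq_bigr => i _ /=.
under eq_bigr => m _ do under eq_bigr => l _ do rewrite big_distrl /=.
under eq_bigr => m _ do rewrite exchange_big /=.
rewrite exchange_big; apply: eq_bigr => j _ /=.
under eq_bigr => m _ do under eq_bigr => l _ do rewrite big_distrl /=.
under eq_bigr => m _ do rewrite exchange_big /=.
rewrite exchange_big; apply: eq_bigr => k _ /=.
rewrite exchange_big; apply: eq_bigr => l _ /=.
rewrite /lowered_riemann big_distrr; apply: eq_bigr => m _ /=.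
by rewrite (metricC m l Ox); ring.
Qed.

(** The difference [t] between the lowered curvature and K times the model tensor [t0] has the
    symmetries of a curvature tensor, and its biquadratic form vanishes; [curvature_tensor_eq0] then
    applies and the index is raised back. *)
Lemma constant_curvature_riemann (K : R) x l k i j : img c x ->
  constant_sectional_curvature M K ->
  riemann c x l k i j =
  K * ((l == i)%:R * metric c x j k - (l == j)%:R * metric c x i k).
Proof.
move=> Ox MK.
pose t0 l k i j := metric c x l i * metric c x j k - metric c x l j * metric c x i k.
pose t l k i j := lowered_riemann c x l k i j + - K * t0 l k i j.
have t12 l' k' i' j' : t l' k' i' j' = - t l' k' j' i'.
  rewrite /t /t0.
  have -> : lowered_riemann c x l' k' i' j' = - lowered_riemann c x l' k' j' i'.
    rewrite /lowered_riemann -sumrN; apply: eq_bigr => m _.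
    by rewrite riemann_antisym mulrN.
  by ring.
have t_eq0 : forall l k i j, t l k i j = 0.
  apply: curvature_tensor_eq0 => // [l' k' i' j'|l' k' i' j'|u v].
  - rewrite /t /t0 lowered_riemann_skew // (metricC k' i' Ox) (metricC j' l' Ox).
    by rewrite (metricC k' j' Ox) (metricC i' l' Ox); ring.
  - have E : lowered_riemann c x l' k' i' j' + lowered_riemann c x l' i' j' k'
        + lowered_riemann c x l' j' k' i' = 0.
      rewrite /lowered_riemann -!big_split big1 // => m _ /=.
      by rewrite -!mulrDr riemann_bianchi ?mulr0.
    rewrite /t /t0 (metricC k' j' Ox) (metricC j' i' Ox) (metricC k' i' Ox).
    by move: E; move: (lowered_riemann _ _ _ _ _ _) (lowered_riemann _ _ _ _ _ _)
      (lowered_riemann _ _ _ _ _ _) => p q r E; rewrite -[RHS]E; ring.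
  have [uv|] := boolP (row_free (col_mx u v)).
    have E : qform (lowered_riemann c x) u v v u =
        K * (inner c x u u * inner c x v v - inner c x u v ^+ 2).
      by rewrite -(MK c x u v Ox uv) /sectional inner_curvature // divfK // gram_det_neq0.
    rewrite qform_lin E /t0.
    have -> : qform (fun l k i j => metric c x l i * metric c x j k
        - metric c x l j * metric c x i k) u v v u =
        inner c x u u * inner c x v v - inner c x u v ^+ 2.
      have := qform_lin (-1) (fun l k i j => metric c x l i * metric c x j k)
        (fun l k i j => metric c x l j * metric c x i k) u v v u.
      rewrite qform_prod.
      have -> : qform (fun l k i j => metric c x l j * metric c x i k) u v v u =
          inner c x u v ^+ 2.
        transitivity (qform (fun l k i j => metric c x l i * metric c x j k) v u v u).
          rewrite /qform exchange_big; do 4!(apply: eq_bigr => ? _); ring.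
        rewrite qform_prod expr2 !innerE; congr (_ * _).
        rewrite exchange_big; apply: eq_bigr => p _; apply: eq_bigr => q _; ring.
      have -> : (\sum_p \sum_q u 0 p * metric c x q p * u 0 q) = inner c x u u.
        by rewrite innerE; do 2!(apply: eq_bigr => ? _); rewrite (metricC _ _ Ox).
      rewrite -innerE mulN1r => <-.
      by apply: eq_qform => l' k' i' j'; ring.
    by ring.
  (* For dependent [u] and [v] the curvature hypothesis says nothing, but one vector is then a
     multiple of the other and skew symmetry in the first two arguments suffices. *)
  rewrite -kermx_eq0 => /rowV0Pn[y /sub_kermxP yuv y0].
  move: yuv y0; rewrite -[y]hsubmxK [lsubmx y]mx11_scalar [rsubmx y]mx11_scalar.
  move: (lsubmx y 0 0) (rsubmx y 0 0) => a b; rewrite col_mx2_comb => E y0.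
  have [a0|a0] := eqVneq a 0.
    have b0 : b != 0.
      by apply: contraNneq y0 => b0; rewrite a0 b0 !raddf0 row_mx0.
    have -> : v = 0 *: u.
      by move/eqP: E; rewrite a0 !scale0r add0r scaler_eq0 (negbTE b0) => /eqP.
    by rewrite qformZ2 mul0r.
  have -> : u = (- b / a) *: v.
    apply: (scalerI a0); rewrite scalerA mulrC divfK // scaleNr.
    by apply/eqP; rewrite -subr_eq0 opprK E.
  by rewrite qformZ1 qform_skew ?mulr0.
have -> : riemann c x l k i j = \sum_p cometric c x l p * lowered_riemann c x p k i j.
  rewrite /lowered_riemann; under eq_bigr do rewrite big_distrr.
  rewrite exchange_big /=.
  under eq_bigr do under eq_bigr do rewrite mulrA.
  under eq_bigr => m _ do rewrite -big_distrl (cometric_metric l m Ox).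
  by rewrite (sum_delta l (fun m => riemann c x m k i j)).
have lE p : lowered_riemann c x p k i j = K * t0 p k i j.
  by have /eqP := t_eq0 p k i j; rewrite /t mulNr subr_eq0 => /eqP.
under eq_bigr do rewrite lE mulrCA.
rewrite -big_distrr; congr (_ * _) => /=.
under eq_bigr do rewrite mulrBr !mulrA.
by rewrite sumrB -!big_distrl /= !cometric_metric.
Qed.

End ConstantCurvature.

(** * Operations on parallel tensors *)

Section ParallelTensors.
Context {R : realType} {n : nat} (M : riemannian_manifold R n).
Implicit Types (c d : atlas M) (x : 'rV[R]_n).
Local Open Scope complex_scope.

Definition cmetric c x (a b : 'I_n) : R[i] := (metric c x a b)%:C.
Definition ccometric c x (a b : 'I_n) : R[i] := (cometric c x a b)%:C.

Lemma overlap_img c d x : overlap (chart_of c) (chart_of d) x ->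
  img d (transition (chart_of c) (chart_of d) x).
Proof. by move=> [_ dx]; apply: cmap_cimg. Qed.

(** Inverting [metric_transition] is possible because the Jacobian is a factor of the invertible
    matrix [metric c x]. *)
Lemma cometric_transition c d x : overlap (chart_of c) (chart_of d) x ->
  let J := transition_jac (chart_of c) (chart_of d) x in
  cometric d (transition (chart_of c) (chart_of d) x) = J^T *m cometric c x *m J.
Proof.
move=> cdx J; have gE := metric_transition cdx; rewrite -/J in gE.
have Ox : img c x by case: cdx.
have gU := metric_unit (overlap_img cdx); have gcU := metric_unit Ox.
have JU : J^T \in unitmx.
  by move: gcU; rewrite gE !unitmx_mul => /andP[_].
set gd := metric d _ in gE gU *.
have E : J^T *m cometric c x *m J *m gd = 1%:M.
  apply: (can_inj (mulmxK JU)); rewrite mul1mx -!mulmxA (mulmxA J) -gE.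
  by rewrite mulVmx ?mulmx1.
by rewrite -[RHS](mulmxK gU) E mul1mx.
Qed.

Lemma permute_transition r (s : 'S_r) c d x (A : r.-tuple 'I_n) (X : parallel_tensor M r) :
  overlap (chart_of c) (chart_of d) x ->
  X d (transition (chart_of c) (chart_of d) x) (permute s A) =
  \sum_(I : r.-tuple 'I_n)
    (\prod_(t < r) transition_jac (chart_of c) (chart_of d) x
                     (tnth I t) (tnth A t))%:C * X c x (permute s I).
Proof.
move=> cdx; rewrite comp_transition // -(sum_permute s); apply: eq_bigr => I _.
congr (_%:C * _); rewrite [RHS](reindex_perm s) /=.
by apply: eq_bigr => t _; rewrite !tnth_mktuple.
Qed.

(** Transparent, like the constructions that follow: later pairings unfold the components of the new
    tensors. *)
Definition ptensor_permute r (s : 'S_r) (X : parallel_tensor M r) : parallel_tensor M r.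
Proof.
refine (@ParallelTensor R n M r (fun c x I => X c x (permute s I)) _ _ _).
- by move=> c I; apply: comp_smooth.
- by move=> c d x A cdx; apply: permute_transition.
- move=> c x i I Ox.
  rewrite -[LHS]/(nab (levi_civita c) i (fun y J => X c y (permute s J)) x I).
  by rewrite nab_permute; apply: comp_parallel.
Defined.

Lemma prod_tuple_cons2 r (J : 'M[R]_n) (i j a b : 'I_n) (I A : r.-tuple 'I_n) :
  \prod_(t < r.+2) J (tnth [tuple of i :: j :: I] t) (tnth [tuple of a :: b :: A] t) =
  J i a * (J j b * \prod_(t < r) J (tnth I t) (tnth A t)).
Proof.
rewrite !big_ord_recl !tnth0 !tnthS !tnth0; do 2!congr (_ * _).
by apply: eq_bigr => t _; rewrite !tnthS.
Qed.

(** The transformation law of the metric absorbs the two Jacobian factors of the contracted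
    slots. *)
Lemma contr2_transition r c d x (A : r.-tuple 'I_n) (X : parallel_tensor M r.+2) :
  overlap (chart_of c) (chart_of d) x ->
  let y := transition (chart_of c) (chart_of d) x in
  contr2 (cmetric d y) (X d y) A =
  \sum_(I : r.-tuple 'I_n)
    (\prod_(t < r) transition_jac (chart_of c) (chart_of d) x
                     (tnth I t) (tnth A t))%:C * contr2 (cmetric c x) (X c x) I.
Proof.
move=> cdx y; set J := transition_jac _ _ _.
have gE i j : cmetric c x i j = \sum_a \sum_b (J i a)%:C * (J j b)%:C * cmetric d y a b.
  rewrite /cmetric (metric_transition cdx) -/J -/y mxE exchange_big rmorph_sum /=.
  apply: eq_bigr => b _; rewrite !mxE big_distrl rmorph_sum /=; apply: eq_bigr => a _.
  by rewrite !rmorphM /= mulrAC.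
transitivity (\sum_a \sum_b \sum_(I : r.-tuple 'I_n) \sum_i \sum_j
   ((\prod_(t < r) J (tnth I t) (tnth A t))%:C * X c x [tuple of i :: j :: I]) *
     ((J i a)%:C * (J j b)%:C * cmetric d y a b)).
  apply: eq_bigr => a _; apply: eq_bigr => b _.
  rewrite comp_transition // sum_tuple_cons big_distrr [RHS]exchange_big /=.
  apply: eq_bigr => i _; rewrite sum_tuple_cons big_distrr [RHS]exchange_big /=.
  apply: eq_bigr => j _.
  rewrite big_distrr; apply: eq_bigr => I _ /=.
  by rewrite prod_tuple_cons2 !rmorphM /=; ring.
under eq_bigr => a _ do rewrite exchange_big.
rewrite exchange_big; apply: eq_bigr => I _ /=.
rewrite /contr2 big_distrr /=.
under eq_bigr => a _ do rewrite exchange_big.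
rewrite exchange_big; apply: eq_bigr => i _ /=.
under eq_bigr => a _ do rewrite exchange_big.
rewrite exchange_big big_distrr; apply: eq_bigr => j _ /=.
rewrite gE big_distrl big_distrr; apply: eq_bigr => a _ /=.
rewrite big_distrl big_distrr; apply: eq_bigr => b _ /=.
by ring.
Qed.

Definition ptensor_contr r (X : parallel_tensor M r.+2) : parallel_tensor M r.
Proof.
refine (@ParallelTensor R n M r (fun c x => contr2 (cmetric c x) (X c x)) _ _ _).
- move=> c I.
  exact: (csmooth_on_contr2 (@img_open _ _ M c) (@msmooth_metric _ _ M c)
    (@comp_smooth _ _ _ _ X c)).
- by move=> c d x A cdx; apply: contr2_transition.
- move=> c x i I Ox.
  rewrite -[LHS]/(nab (levi_civita c) i (fun y => contr2 (cmetric c y) (X c y)) x I).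
  have -> := nab_contr2 (@img_open _ _ M c) i I (@msmooth_metric _ _ M c)
    (@metric_parallel _ _ M c) (@comp_smooth _ _ _ _ X c) Ox.
  rewrite /contr2 big1 // => a _; rewrite big1 // => b _.
  by rewrite [X in _ * X](@comp_parallel _ _ _ _ X) ?mulr0.
Defined.

Lemma tens2_transition r c d x (A : r.+2.-tuple 'I_n) (X : parallel_tensor M r) :
  overlap (chart_of c) (chart_of d) x ->
  let y := transition (chart_of c) (chart_of d) x in
  tens2 (ccometric d y) (X d y) A =
  \sum_(I : r.+2.-tuple 'I_n)
    (\prod_(t < r.+2) transition_jac (chart_of c) (chart_of d) x
                     (tnth I t) (tnth A t))%:C * tens2 (ccometric c x) (X c x) I.
Proof.
move=> cdx y; have [a [b [A' ->]]] := tuple_eta2 A.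
rewrite tens2_cons comp_transition //; set J := transition_jac _ _ _.
have hE : ccometric d y a b = \sum_i \sum_j (J i a)%:C * (J j b)%:C * ccometric c x i j.
  rewrite /ccometric (cometric_transition cdx) -/J mxE exchange_big rmorph_sum /=.
  apply: eq_bigr => j _; rewrite !mxE big_distrl rmorph_sum /=; apply: eq_bigr => i _.
  by rewrite !mxE !rmorphM /= mulrAC.
rewrite sum_tuple_cons hE big_distrl; apply: eq_bigr => i _ /=.
rewrite sum_tuple_cons big_distrl; apply: eq_bigr => j _ /=.
rewrite big_distrr; apply: eq_bigr => I _ /=.
by rewrite tens2_cons prod_tuple_cons2 !rmorphM /=; ring.
Qed.

Definition ptensor_tens r (X : parallel_tensor M r) : parallel_tensor M r.+2.
Proof.
refine (@ParallelTensor R n M r.+2 (fun c x => tens2 (ccometric c x) (X c x)) _ _ _).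
- move=> c I.
  exact: (csmooth_on_tens2 (@img_open _ _ M c) (@msmooth_cometric _ _ M c)
    (@comp_smooth _ _ _ _ X c)).
- by move=> c d x A cdx; apply: tens2_transition.
- move=> c x i I Ox.
  rewrite -[LHS]/(nab (levi_civita c) i (fun y => tens2 (ccometric c y) (X c y)) x I).
  have -> := nab_tens2 (@img_open _ _ M c) i I (@msmooth_cometric _ _ M c)
    (@cometric_parallel _ _ M c) (@comp_smooth _ _ _ _ X c) Ox.
  by rewrite /tens2 [X in _ * X](@comp_parallel _ _ _ _ X) ?mulr0.
Defined.

Definition ptensor_cst (a : R[i]) : parallel_tensor M 0.
Proof.
refine (@ParallelTensor R n M 0 (fun _ _ _ => a) _ _ _).
- by move=> c I; apply: csmooth_on_cst; exact: img_open.
- by move=> c d x A _; rewrite sum_tuple0 big_ord0 mul1r.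
- by move=> c x i I _; rewrite /nabla_contra cpartial_cst big_ord0 addr0.
Defined.

End ParallelTensors.

(** * Orthonormal bases and parallel functions *)

(** Gram-Schmidt by blocks: clear the first row and column, scale the first vector, and apply the
    induction hypothesis to the rest. *)
Lemma posdef_orthonormal (R : rcfType) (n : nat) (g : 'M[R]_n) : g^T = g ->
  (forall v : 'rV[R]_n, v != 0 -> 0 < (v *m g *m v^T) 0 0) ->
  exists E : 'M[R]_n, E *m g *m E^T = 1%:M.
Proof.
elim: n => [|n IH] in g *.
  by move=> _ _; exists 0; apply/matrixP => - [].
move: g; rewrite -[n.+1]/(1 + n)%N => g gT gpos.
pose a : R := ulsubmx g 0 0; pose b := ursubmx g; pose d := drsubmx g.
have gE : g = block_mx a%:M b b^T d.
  have -> : b^T = dlsubmx g by rewrite /b trmx_ursub gT.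
  by rewrite -mx11_scalar submxK.
have dT : d^T = d by rewrite /d trmx_drsub gT.
have a0 : 0 < a.
  have := gpos (row_mx 1%:M 0); rewrite gE mul_row_block tr_row_mx mul_row_col.
  rewrite !mul1mx !mul0mx !addr0 trmx1 mulmx1 trmx0 mulmx0 addr0 mxE eqxx mulr1n.
  apply; apply/negP => /eqP/(congr1 (fun A => lsubmx A 0 0)).
  by rewrite row_mxKl !mxE => /eqP; rewrite oner_eq0.
have an0 : a != 0 by rewrite gt_eqF.
(* The Schur complement of the corner [a]. It is again positive definite because [P] carries [g] to
   the block diagonal matrix with blocks [a] and [s]. *)
pose s := d - a^-1 *: (b^T *m b).
pose P : 'M[R]_(1 + n) := block_mx 1%:M 0 (- (a^-1 *: b^T)) 1%:M.
have Pg : P *m g = block_mx a%:M b 0 s.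
  rewrite /P gE mulmx_block !mul1mx !mul0mx !addr0; congr block_mx.
    by rewrite mulNmx -scalemxAl mul_mx_scalar scalerA mulVf // scale1r addNr.
  by rewrite mulNmx -scalemxAl addrC.
have PgP : P *m g *m P^T = block_mx a%:M 0 0 s.
  rewrite Pg /P tr_block_mx mulmx_block !trmx1 !trmx0 !mulmx1 !mulmx0 !mul0mx.
  rewrite !addr0 !add0r; congr block_mx.
  by rewrite linearN linearZ /= trmxK mulmxN mul_scalar_mx scalerA mulfV // scale1r addNr.
have sT : s^T = s by rewrite /s linearB linearZ /= trmx_mul trmxK dT.
have [w w0|E' E'1] := IH s sT.
  pose v := row_mx 0 w *m P.
  have v0 : v != 0.
    apply: contraNneq w0; rewrite /v /P mul_row_block !mul0mx !add0r mulmx1.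
    by move/(congr1 rsubmx); rewrite row_mxKr linear0 => ->.
  have := gpos v v0; rewrite /v trmx_mul -!mulmxA (mulmxA g) (mulmxA P) (mulmxA P) PgP.
  rewrite mulmxA mul_row_block tr_row_mx mul_row_col.
  by rewrite !mul0mx !mulmx0 !add0r trmx0 mulmx0 add0r mulmxA.
pose D : 'M[R]_(1 + n) := block_mx (Num.sqrt a)^-1%:M 0 0 E'.
exists (D *m P); rewrite trmx_mul -!mulmxA (mulmxA g) (mulmxA P) (mulmxA P) PgP mulmxA.
rewrite /D tr_block_mx !mulmx_block !trmx0 !mul0mx !mulmx0 !addr0 !add0r.
rewrite tr_scalar_mx -!scalar_mxM E'1 mulrAC -expr2 exprVn sqr_sqrtr ?ltW //.
by rewrite mulVf // !mul0mx -scalar_mx_block.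
Qed.

(** * Orthonormal bases at a point and parallel tensors of degree 0 *)

Section Manifold.
Context {R : realType} {n : nat} (M : riemannian_manifold R n).

(** From E g E^T = 1 follows E^T E = g^-1; this turns the trace over an orthonormal basis into a
    contraction with the inverse metric. *)
Lemma orthonormal_basis_exists (c : atlas M) x : img c x ->
  exists2 E : 'M[R]_n, orthonormal_basis c x E &
    forall i j, \sum_a E a i * E a j = cometric c x i j.
Proof.
move=> Ox; have [E EgE] := posdef_orthonormal (Defs.metric_sym Ox) (metric_posdef Ox).
exists E => [a b|i j].
  rewrite /inner -row_mul tr_row -[RHS](mxE matrix_key (fun a b => (a == b)%:R) a b).
  have := congr1 (fun A : 'M[R]_n => A a b) EgE; rewrite !mxE => <-.
  by apply: eq_bigr => k _; rewrite !mxE.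
have EU : E \in unitmx.
  by have := unitmx1 R n; rewrite -EgE !unitmx_mul => /andP[/andP[]].
have -> : cometric c x = E^T *m E.
  have gU := metric_unit Ox.
  rewrite -[RHS](mulmxK gU); suff -> : E^T *m E *m metric c x = 1%:M by rewrite mul1mx.
  have ETU : E^T \in unitmx by rewrite unitmx_tr.
  apply: (can_inj (mulmxK ETU)); rewrite mul1mx -!mulmxA (mulmxA E) EgE mulmx1 //.
by rewrite mxE; apply: eq_bigr => a _; rewrite mxE.
Qed.

Lemma ptensor0_chart (X : parallel_tensor M 0) (c d : atlas M) (p : M) :
  cdom (chart_of c) p -> cdom (chart_of d) p ->
  X d (Defs.coord d p) [tuple] = X c (Defs.coord c p) [tuple].
Proof.
move=> cp dp; have := @comp_transition _ _ _ _ X c d (Defs.coord c p) [tuple].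
rewrite /transition cmapK // => ->; last first.
  by split; [apply: cmap_cimg|rewrite cmapK].
by rewrite sum_tuple0 big_ord0 mul1r.
Qed.

Lemma ptensor0_locally_constant (X : parallel_tensor M 0) (c : atlas M) (p : M) :
  cdom (chart_of c) p ->
  \forall q \near p, cdom (chart_of c) q /\
    X c (Defs.coord c q) [tuple] = X c (Defs.coord c p) [tuple].
Proof.
move=> cp; have Ox : img c (Defs.coord c p) by apply: cmap_cimg.
have oO := @img_open _ _ M c.
have [s1 s2] := comp_smooth X c [tuple].
have d0 i y : img c y -> cpartial i (fun y => X c y [tuple]) y = 0.
  move=> Oy; have := @comp_parallel _ _ _ _ X c y i [tuple] Oy.
  by rewrite /nabla_contra big_ord0 addr0.
have n1 := partial0_locally_constant oO s1
  (fun i y Oy => congr1 (fun z => complex.Re z) (d0 i y Oy)) Ox.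
have n2 := partial0_locally_constant oO s2
  (fun i y Oy => congr1 (fun z => complex.Im z) (d0 i y Oy)) Ox.
have n3 : \forall y \near Defs.coord c p, X c y [tuple] = X c (Defs.coord c p) [tuple].
  by apply: filterS2 n1 n2 => y; apply: complex_eq.
have cdn : nbhs p (cdom (chart_of c)).
  by apply: open_nbhs_nbhs; split => //; apply: cdom_open.
apply: filterS2 cdn (cmap_continuous cp n3) => q ? ?; by split.
Qed.

(** The value read in the chart chosen at each point is a locally constant function on M, as values
    of degree 0 do not depend on the chart. Its level sets are open and closed. *)
Lemma ptensor0_constant (X : parallel_tensor M 0) : connected [set: M] ->
  exists a : R[i], forall c x, img c x -> X c x [tuple] = a.
Proof.
move=> Mconn.
(* The empty space is connected too; it has no chart points, so any constant serves. *)
have [[p0 _]|M0] := pselect (exists p : M, True); last first.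
  by exists 0 => c x Ox; case: M0; exists (Defs.point c x).
pose F (p : M) := X (chart_at p) (Defs.coord (chart_at p) p) [tuple].
have ch (p : M) : cdom (chart_of (chart_at p)) p by rewrite /chart_at; case: cid.
have loc (p : M) : \forall q \near p, F q = F p.
  have := ptensor0_locally_constant X (ch p); apply: filterS => q [cq E].
  by rewrite /F -E; apply: ptensor0_chart.
have oF (P : set R[i]) : open [set p | P (F p)].
  rewrite openE => p /= Pp.
  suff : nbhs p [set q | P (F q)] by [].
  by have := loc p; apply: filterS => q /= ->.
have FT : [set p | F p = F p0] = setT.
  apply: Mconn; first by exists p0.
    by exists [set p | F p = F p0]; rewrite ?setTI //; apply: (oF [set z | z = F p0]).
  exists [set p | F p = F p0]; rewrite ?setTI //.
  by rewrite -openC; apply: (oF [set z | z <> F p0]).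
exists (F p0) => c x Ox.
have -> : F p0 = F (Defs.point c x).
  by have : [set: M] (Defs.point c x) by []; rewrite -FT => /= ->.
have cx : cdom (chart_of c) (Defs.point c x) by apply: cinv_cdom.
by rewrite /F (ptensor0_chart X cx (ch _)) /Defs.coord /Defs.point cinvK.
Qed.

End Manifold.

(** * Iterated covariant derivatives *)

Section IteratedDerivatives.
Context {R : realType} {n : nat} (M : riemannian_manifold R n).
Variables (U : set M) (f : M -> R[i]).
Hypotheses (U_open : open U) (f_smooth : smooth_fun U f).
Implicit Types (c : atlas M) (x : 'rV[R]_n).
Local Open Scope complex_scope.

Definition imgU c : set 'rV[R]_n := [set x | img c x /\ U (Defs.point c x)].

Lemma imgU_open c : open (imgU c).
Proof.
rewrite openE => x [Ox Ux].
have nO : nbhs x (img c).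
  by apply: open_nbhs_nbhs; split => //; exact: img_open.
have nU : nbhs (cinv (chart_of c) x) U by apply: open_nbhs_nbhs; split.
by have := cinv_continuous Ox nU; apply: filterS2 nO.
Qed.

Lemma imgU_img c : imgU c `<=` img c. Proof. by move=> x []. Qed.

Definition dual_lc c : connection := dual_connection (levi_civita c).

Definition iter_nabla c m : tfield m := fun x I => nabla_iter c f x I.

Lemma nabla_covE c m (om : tfield m) i x I :
  nabla_cov c om i x I = nab (dual_lc c) i om x I.
Proof.
congr (_ + _); rewrite -sumrN; apply: eq_bigr => s _; rewrite -sumrN.
by apply: eq_bigr => l _; rewrite rmorphN mulNr.
Qed.

Lemma iter_nabla_cons c m x i (J : m.-tuple 'I_n) :
  iter_nabla c x [tuple of i :: J] = nab (dual_lc c) i (@iter_nabla c m) x J.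
Proof.
rewrite /iter_nabla /= nabla_covE theadE; congr nab; exact: val_inj.
Qed.

Lemma msmooth_sub (O O' : set 'rV[R]_n) A : O' `<=` O -> msmooth O A -> msmooth O' A.
Proof. by move=> OO sA k l; apply: smooth_on_sub OO (sA k l). Qed.

Lemma msmooth_dual_lc c i : msmooth (imgU c) (dual_lc c i).
Proof.
apply: (msmooth_sub (@imgU_img c)).
by apply: msmooth_dual; apply: msmooth_levi_civita.
Qed.

Lemma tsmooth_iter_nabla c m : tsmooth (imgU c) (@iter_nabla c m).
Proof.
elim: m => [|m IH] I; first exact: (f_smooth c).
case/tupleP: I => i J.
have sN := tsmooth_nab (@imgU_open c) (@msmooth_dual_lc c i) IH J.
apply: (csmooth_on_eq (@imgU_open c) _ sN) => x _.
by rewrite iter_nabla_cons.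
Qed.

Lemma nab_cons (G : connection) i m (T : tfield m.+1) x j (J : m.-tuple 'I_n) :
  nab G i T x [tuple of j :: J] = nab G i (fun y K => T y [tuple of j :: K]) x J
  + \sum_l (G i x j l)%:C * T x [tuple of l :: J].
Proof. by rewrite /nab slot_cons [X in _ + X]addrC addrA. Qed.

(** The index [j] of the inner derivative is itself a slot for the outer one. With [j] frozen as a
    direction, [nab] omits the connection term of that slot; the last sum restores it. *)
Lemma iter_nabla_cons2 c m x i j (J : m.-tuple 'I_n) : imgU c x ->
  iter_nabla c x [tuple of i :: j :: J] =
  nab (dual_lc c) i (nab (dual_lc c) j (@iter_nabla c m)) x J
  + \sum_l (dual_lc c i x j l)%:C * iter_nabla c x [tuple of l :: J].
Proof.
move=> Ox; rewrite iter_nabla_cons nab_cons; congr (_ + _).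
by apply: (nab_ext (@imgU_open c) _ _ _ Ox) => y K _; rewrite iter_nabla_cons.
Qed.

(** The extra terms of [iter_nabla_cons2] are symmetric in [a] and [b] since the connection has no
    torsion, so only the commutator of [nab] remains. *)
Lemma iter_nabla_ricci c m x a b (J : m.-tuple 'I_n) : imgU c x ->
  iter_nabla c x [tuple of a :: b :: J] - iter_nabla c x [tuple of b :: a :: J] =
  slot (fun k l => (- riemann c x l k a b)%:C) (iter_nabla c x) J.
Proof.
move=> Ox; rewrite !iter_nabla_cons2 //.
have -> : \sum_l (dual_lc c b x a l)%:C * iter_nabla c x [tuple of l :: J] =
    \sum_l (dual_lc c a x b l)%:C * iter_nabla c x [tuple of l :: J].
  apply: eq_bigr => l _; congr ((- _)%:C * _).
  exact/christoffelC/imgU_img.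
move: (\sum_l _) => S; rewrite [X in _ - X]addrC addrKA.
rewrite (ricci_identity (@imgU_open c) a b J (@msmooth_dual_lc c)
  (@tsmooth_iter_nabla c m) Ox).
by apply: eq_slot => // k l; rewrite dual_curvatureE //; apply: imgU_img.
Qed.

(* Both sides depend on [Y] only through the function [<Y, nabla^m f>]. *)
Lemma pairing_hessian c m (Y : parallel_tensor M m) x i j : imgU c x ->
  let h y := \sum_J Y c y J * @iter_nabla c m y J in
  \sum_J Y c x J * iter_nabla c x [tuple of i :: j :: J] =
  cpartial i (cpartial j h) x + \sum_l (dual_lc c i x j l)%:C * cpartial l h x.
Proof.
move=> Ox h.
have sY : tsmooth (imgU c) (Y c).
  by move=> I; apply: csmooth_on_sub (@imgU_img c) (comp_smooth Y c I).
have pair (W : tfield m) k y : tsmooth (imgU c) W -> imgU c y ->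
    cpartial k (fun z => \sum_J Y c z J * W z J) y =
    \sum_J Y c y J * nab (dual_lc c) k W y J.
  move=> sW Oy; rewrite (cpartial_pairing (@imgU_open c) (levi_civita c)) //.
  apply: eq_bigr => J _; rewrite [X in X * _ + _](@comp_parallel _ _ _ _ Y).
    by rewrite mul0r add0r.
  exact: imgU_img.
have dh k y : imgU c y -> cpartial k h y =
    \sum_J Y c y J * iter_nabla c y [tuple of k :: J].
  move=> Oy; rewrite pair //; last exact: tsmooth_iter_nabla.
  by apply: eq_bigr => J _; rewrite iter_nabla_cons.
under eq_bigr => J _ do rewrite iter_nabla_cons2 // mulrDr.
rewrite big_split /=; congr (_ + _); last first.
  under [RHS]eq_bigr => l _ do rewrite dh // big_distrr.
  under eq_bigr => J _ do rewrite big_distrr.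
  rewrite exchange_big; apply: eq_bigr => l _; apply: eq_bigr => J _ /=.
  by rewrite mulrCA.
rewrite -pair //; last by apply: tsmooth_nab;
  [exact: imgU_open|exact: msmooth_dual_lc|exact: tsmooth_iter_nabla].
apply: (cpartial_ext (@imgU_open c) _ Ox) => y Oy; rewrite dh //.
by apply: eq_bigr => J _; rewrite iter_nabla_cons.
Qed.

End IteratedDerivatives.

Arguments imgU_open {R n M U} U_open c.
Arguments imgU_img {R n M} U c.
Arguments tsmooth_iter_nabla {R n M U f} U_open f_smooth c m.

(** * Commuting covariant derivatives *)

Section LowerOrderTerms.
Context {R : realType} {n : nat} (M : riemannian_manifold R n).
Variables (U : set M) (f : M -> R[i]).
Hypotheses (U_open : open U) (f_smooth : smooth_fun U f).
Variables (K : R) (M_curvature : constant_sectional_curvature M K).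
Implicit Types (c : atlas M) (x : 'rV[R]_n).
Local Open Scope complex_scope.

Local Notation D c x I := (iter_nabla f c x I).
Local Notation dom c := (imgU U c).

Definition low_term m (p : R[i] * 'S_m.+2) c : tfield m.+2 :=
  fun x I => p.1 * tens2 (cmetric c x) (iter_nabla f c x) (permute p.2 I).

(* The list [L] is chosen once for all charts: pairing a lower order term with a
   parallel tensor must give the same multiple of [f] in every chart. *)
Definition low m (T : atlas M -> tfield m.+2) : Prop :=
  exists L : seq (R[i] * 'S_m.+2), forall c x I, dom c x ->
    T c x I = \sum_(p <- L) low_term p c x I.

Lemma low0 m : low (fun c (_ : 'rV[R]_n) (_ : m.+2.-tuple 'I_n) => 0).
Proof. by exists [::] => c x I _; rewrite big_nil. Qed.

Lemma lowD m (T T' : atlas M -> tfield m.+2) : low T -> low T' ->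
  low (fun c x I => T c x I + T' c x I).
Proof.
move=> [L LE] [L' LE']; exists (L ++ L') => c x I Ox.
by rewrite big_cat LE // LE'.
Qed.

Lemma low_permute m (s : 'S_m.+2) (T : atlas M -> tfield m.+2) : low T ->
  low (fun c x I => T c x (permute s I)).
Proof.
move=> [L LE]; exists [seq (p.1, (p.2 * s)%g) | p <- L] => c x I Ox.
rewrite big_map LE //; apply: eq_bigr => p _.
by rewrite /low_term permuteM.
Qed.

Lemma low_ext m (T T' : atlas M -> tfield m.+2) :
  (forall c x I, dom c x -> T c x I = T' c x I) -> low T -> low T'.
Proof. by move=> TT [L LE]; exists L => c x I Ox; rewrite -TT // LE. Qed.

Lemma low_sum m (q : nat) (T : 'I_q -> atlas M -> tfield m.+2) :
  (forall s, low (T s)) -> low (fun c x I => \sum_s T s c x I).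
Proof.
move=> lT; elim: q => [|q IH] in T lT *.
  by apply: (low_ext _ (low0 m)) => c x I _; rewrite big_ord0.
have := lowD (lT ord0) (IH (fun s => T (lift ord0 s)) (fun s => lT _)).
by apply: low_ext => c x I _; rewrite big_ord_recl.
Qed.

Lemma permute_swap r (a b : 'I_n) (J : r.-tuple 'I_n) :
  permute (tperm ord0 (lift ord0 ord0)) [tuple of a :: b :: J] =
  [tuple of b :: a :: J].
Proof. by rewrite permute_tperm0 tnth0 replace_at_cons0. Qed.

Lemma tsmooth_low_term m (p : R[i] * 'S_m.+2) c : tsmooth (dom c) (low_term p c).
Proof.
have sg := msmooth_sub (imgU_img U c) (@msmooth_metric _ _ M c).
have sT := csmooth_on_tens2 (imgU_open U_open c) sg (tsmooth_iter_nabla U_open f_smooth c m).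
move=> I; apply: (csmooth_onM (imgU_open U_open c)); last exact: sT.
exact: csmooth_on_cst (imgU_open U_open c) p.1.
Qed.

(** The metric is parallel, so the derivative falls on the iterated derivative of f alone and only
    raises its order. *)
Lemma low_nabla m (T : atlas M -> tfield m.+2) : low T ->
  low (fun c x (I : m.+3.-tuple 'I_n) =>
    nab (dual_lc c) (thead I) (T c) x (behead_tuple I)).
Proof.
move=> [L LE].
pose s01 r : 'S_r.+2 := tperm ord0 (lift ord0 ord0).
(* The new index stands in front of the two indices of the metric and has to follow them: after
   [p.2], the two exchanges take (i, a, b, J') to (a, i, b, J') and then to (a, b, i, J'). *)
exists [seq (p.1, (lift0_perm (s01 m) * s01 m.+1 * lift0_perm p.2)%g) | p <- L].
move=> c x I Ox; case/tupleP: I => i J; rewrite theadE.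
have -> : behead_tuple [tuple of i :: J] = J by apply: val_inj.
rewrite (nab_ext (imgU_open U_open c) (dual_lc c) i J Ox (LE c)).
rewrite (nab_sum (imgU_open U_open c) _ _ _ _ (fun p => tsmooth_low_term p c) Ox) big_map.
apply: eq_bigr => p _; rewrite /low_term.
have sg := msmooth_sub (imgU_img U c) (@msmooth_metric _ _ M c).
have sD := tsmooth_iter_nabla U_open f_smooth c m.
have sT := csmooth_on_tens2 (imgU_open U_open c) sg sD.
have sP : tsmooth (dom c) (fun y I => tens2 (cmetric c y) (iter_nabla f c y)
    (permute p.2 I)) by move=> I; apply: sT.
have pg : parallel2 (dom c) (dual_lc c) (fun x a b => metric c x a b).
  by move=> k y a b Oy; apply: metric_parallel; apply: imgU_img Oy.
rewrite (nabZ (imgU_open U_open c) (dual_lc c) i p.1 J sP Ox).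
congr (_ * _).
rewrite (nab_permute (dual_lc c) i p.2
  (fun y => tens2 (cmetric c y) (@iter_nabla _ _ M f c m y)) x J).
rewrite [LHS](nab_tens2 (imgU_open U_open c) i _ sg pg sD Ox).
rewrite -!permuteM permute_lift0; have [a [b [J' ->]]] := tuple_eta2 (permute p.2 J).
by rewrite permute_swap permute_lift0 permute_swap !tens2_cons iter_nabla_cons.
Qed.

(** Here constant curvature enters: the curvature acting on slot [s] is a difference of two products
    of a delta and a metric entry, and the delta puts [b] or [a] in that slot. *)
Lemma low_swap01 m : low (fun c x (I : m.+2.-tuple 'I_n) =>
  D c x I - D c x (permute (tperm ord0 (lift ord0 ord0)) I)).
Proof.
pose s01 : 'S_m.+2 := tperm ord0 (lift ord0 ord0).
(* [tau s] exchanges [b] with the entry of [J] in slot [s], which then stands next to [a] in the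
   metric. *)
pose tau (s : 'I_m) : 'S_m.+2 := lift0_perm (tperm ord0 (lift ord0 s)).
have lt k s : low (low_term (k, tau s) (m := m)).
  by exists [:: (k, tau s)] => c x I _; rewrite big_seq1.
have : low (fun c x I => \sum_s (low_term (K%:C, tau s) c x I
     + low_term ((- K)%:C, tau s) c x (permute s01 I))).
  apply: low_sum => s; apply: lowD; first exact: lt.
  exact: low_permute (lt _ _).
apply: low_ext => c x I Ox; have [a [b [J ->]]] := tuple_eta2 I.
rewrite permute_swap (iter_nabla_ricci U_open f_smooth _ _ _ Ox) /slot.
apply: eq_bigr => s _; rewrite /low_term /tau /=.
rewrite !permute_lift0 !permute_tperm0 !tens2_cons /cmetric.
transitivity (
  \sum_l (l == b)%:R *
    (K%:C * ((metric c x a (tnth J s))%:C * D c x (replace_at J s l)))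
  + \sum_l (l == a)%:R *
    ((- K)%:C * ((metric c x b (tnth J s))%:C * D c x (replace_at J s l)))).
  congr (_ + _).
    under eq_bigr do rewrite eq_sym.
    by rewrite (sum_delta b (fun l => K%:C * (_ * D c x (replace_at J s l)))).
  under eq_bigr do rewrite eq_sym.
  by rewrite (sum_delta a (fun l => (- K)%:C * (_ * D c x (replace_at J s l)))).
rewrite -big_split; apply: eq_bigr => l _ /=.
rewrite (constant_curvature_riemann _ _ _ _ (imgU_img _ _ _ Ox) M_curvature).
rewrite !(rmorphN, rmorphM, rmorphB, rmorph_nat) /=; ring.
Qed.

Definition low_perm m (s : 'S_m.+2) : Prop := low (fun c x (I : m.+2.-tuple 'I_n) =>
  D c x I - D c x (permute s I)).

Lemma low_perm1 m : low_perm (1 : 'S_m.+2)%g.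
Proof. by apply: (low_ext _ (low0 m)) => c x I _; rewrite permute1 subrr. Qed.

Lemma low_permM m (s t : 'S_m.+2) : low_perm s -> low_perm t -> low_perm (s * t)%g.
Proof.
move=> ls lt; have := lowD lt (low_permute t ls).
by apply: low_ext => c x I _; rewrite permuteM addrA subrK.
Qed.

Lemma low_perm_lift m (s : 'S_m.+2) : low_perm s -> low_perm (lift0_perm s).
Proof.
move=> /low_nabla; apply: low_ext => c x I Ox; case/tupleP: I => i J; rewrite theadE.
have -> : behead_tuple [tuple of i :: J] = J by apply: val_inj.
have sD := tsmooth_iter_nabla U_open f_smooth c m.+2.
have sP : tsmooth (dom c) (fun y J => @iter_nabla _ _ M f c m.+2 y (permute s J)).
  by move=> K'; apply: sD.
rewrite permute_lift0 !iter_nabla_cons.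
rewrite -(nab_permute (dual_lc c) i s (@iter_nabla _ _ M f c m.+2) x J).
exact: (nabB (imgU_open U_open c) (dual_lc c) i J sD sP Ox).
Qed.

Lemma lift0_tperm r (a b : 'I_r) :
  lift0_perm (tperm a b) = tperm (lift ord0 a) (lift ord0 b).
Proof.
apply/permP => t; have [u|] := unliftP ord0 t => ->.
  by rewrite /lift0_perm lift_perm_lift inj_tperm //; apply: lift_inj.
by rewrite /lift0_perm lift_perm_id tpermD // eq_sym neq_lift.
Qed.

(** Conjugating by the exchange of slots 0 and 1 turns this transposition into one that fixes slot
    0. That one comes from the derivative of one order less through [low_perm_lift]. *)
Lemma low_perm_tperm0 m (s : 'I_m.+1) : low_perm (tperm ord0 (lift ord0 s)).
Proof.
elim: m => [|m IH] in s *; first by rewrite (ord1 s); exact: low_swap01.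
have [t ->|->] := unliftP ord0 s; last exact: low_swap01.
pose s01 : 'S_m.+3 := tperm ord0 (lift ord0 ord0).
have -> : tperm ord0 (lift ord0 (lift ord0 t)) =
    (s01 * lift0_perm (tperm ord0 (lift ord0 t)) * s01)%g.
  rewrite lift0_tperm.
  have -> : (s01 * tperm (lift ord0 ord0) (lift ord0 (lift ord0 t)) * s01 =
      tperm (lift ord0 ord0) (lift ord0 (lift ord0 t)) ^ s01)%g.
    by rewrite conjgE tpermV mulgA.
  by rewrite tpermJ /s01 tpermR tpermD // ?neq_lift.
apply: low_permM; last exact: low_swap01.
by apply: low_permM; [exact: low_swap01|apply/low_perm_lift/IH].
Qed.

Lemma low_perm_lift_tperm0 m (s : 'I_m.+1) : low_perm (lift0_perm (tperm ord0 s)).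
Proof.
have [t|] := unliftP ord0 s => ->; last first.
  by rewrite tperm1 /lift0_perm lift_perm1; apply: low_perm1.
by case: m s t => [|m] s t; [case: t|apply/low_perm_lift/low_perm_tperm0].
Qed.

End LowerOrderTerms.

(** * Parallel tensors acting on an eigenfunction *)

Section Eigenfunction.
Context {R : realType} {n : nat} (M : riemannian_manifold R n).
Hypotheses (n_ge2 : (2 <= n)%N) (M_connected : connected [set: M]).
Variables (K : R) (U : set M) (f : M -> R[i]) (lam : R[i]).
Hypotheses (K_neq0 : K != 0) (M_curvature : constant_sectional_curvature M K).
Hypotheses (U_open : open U) (f_smooth : smooth_fun U f).
Hypothesis f_eigen : laplacian_eq U f (fun p => - lam * f p).
Implicit Types (c : atlas M) (x : 'rV[R]_n).
Local Open Scope complex_scope.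

(** One [k] serves all charts and points. The field [S] is kept general because lower order terms
    are paired with parallel tensors as well. *)
Definition multiple_of_f r (S : atlas M -> tfield r) (X : parallel_tensor M r) : Prop :=
  exists k : R[i], forall c x, imgU U c x ->
    \sum_I X c x I * S c x I = k * f (Defs.point c x).

Definition acts_by_scalars r : Prop := forall X : parallel_tensor M r,
  multiple_of_f (fun c => @iter_nabla _ _ M f c r) X.

(** Pairing [X] with a permuted g (x) W amounts to pairing W with the contraction of the permuted
    [X], a parallel tensor of degree [m]. *)
Lemma low_multiple m (T : atlas M -> tfield m.+2) (X : parallel_tensor M m.+2) :
  acts_by_scalars m -> low U f T -> multiple_of_f T X.
Proof.
move=> Qm [L LE].
suff [k kE] : exists k : R[i], forall c x, imgU U c x ->
    \sum_I X c x I * \sum_(p <- L) low_term f p c x I = k * f (Defs.point c x).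
  exists k => c x Ox; rewrite -kE //; apply: eq_bigr => I _; by rewrite LE.
elim: L {LE} => [|p L [k IH]].
  exists 0 => c x _; rewrite mul0r big1 // => I _; by rewrite big_nil mulr0.
have [l lE] := Qm (ptensor_contr (ptensor_permute p.2^-1 X)).
exists (p.1 * l + k) => c x Ox.
under eq_bigr do rewrite big_cons mulrDr.
rewrite big_split /= IH // mulrDl; congr (_ + _).
rewrite -mulrA -lE // /low_term.
under eq_bigr do rewrite mulrCA.
rewrite -big_distrr /=; congr (_ * _).
rewrite -[LHS](sum_permute (p.2^-1)%g).
under [LHS]eq_bigr do rewrite permuteVK.
rewrite [LHS]sum_tuple_cons.
under [LHS]eq_bigr do rewrite sum_tuple_cons.
under [RHS]eq_bigr do rewrite /contr2 big_distrl.
rewrite [RHS]exchange_big; apply: eq_bigr => a _ /=.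
under [RHS]eq_bigr do rewrite big_distrl.
rewrite [RHS]exchange_big; apply: eq_bigr => b _ /=.
by apply: eq_bigr => J _; rewrite tens2_cons /=; ring.
Qed.

Lemma laplacian_cometric c x : imgU U c x ->
  \sum_i \sum_j ccometric c x i j * iter_nabla f c x [tuple of i :: j :: [tuple]] =
  - lam * f (Defs.point c x).
Proof.
move=> [Ox Ux]; have [E Eo EE] := orthonormal_basis_exists Ox.
rewrite -(f_eigen Ox Ux Eo) /hessian [RHS]exchange_big; apply: eq_bigr => i _ /=.
rewrite [RHS]exchange_big; apply: eq_bigr => j _ /=.
have -> : [tuple i; j] = [tuple of i :: j :: [tuple]] by apply: val_inj.
rewrite -big_distrl /=; congr (_ * _).
rewrite -rmorph_sum /ccometric -EE; congr (_%:C).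
by apply: eq_bigr => a _; rewrite !mxE.
Qed.

(** The pairing of [Y] with the [m]-th derivative is k f on U, so its Hessian is k times that of f;
    contracting with the inverse metric gives - lam k f. *)
Lemma tens_multiple m (Y : parallel_tensor M m) : acts_by_scalars m ->
  multiple_of_f (fun c => @iter_nabla _ _ M f c m.+2) (ptensor_tens Y).
Proof.
move=> Qm; have [k kE] := Qm Y.
exists (k * - lam) => c x Ox; rewrite -mulrA -laplacian_cometric //.
have h i j : \sum_J Y c x J * iter_nabla f c x [tuple of i :: j :: J] =
    k * iter_nabla f c x [tuple of i :: j :: [tuple]].
  rewrite (pairing_hessian U_open f_smooth Y i j Ox).
  (* The Hessian of k f itself, obtained from the same lemma by viewing k f as the action of the
     constant tensor [k]. *)
  have := pairing_hessian U_open f_smooth (ptensor_cst M k) i j Ox.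
  rewrite sum_tuple0 => ->.
  have hE l y : imgU U c y -> cpartial l (fun y => \sum_J Y c y J * iter_nabla f c y J) y =
     cpartial l (fun y => \sum_J ptensor_cst M k c y J * iter_nabla f c y J) y.
    move=> Oy; apply: (cpartial_ext (imgU_open U_open c) l Oy) => z Oz.
    by rewrite kE // sum_tuple0.
  apply: (f_equal2 +%R).
    by apply: (cpartial_ext (imgU_open U_open c) i Ox) => y Oy; rewrite hE.
  by apply: eq_bigr => l _; rewrite hE.
rewrite sum_tuple_cons big_distrr; apply: eq_bigr => i _ /=.
rewrite sum_tuple_cons big_distrr; apply: eq_bigr => j _ /=.
rewrite mulrCA -h big_distrr; apply: eq_bigr => J _ /=.
by rewrite tens2_cons mulrA.
Qed.

(** Both second derivatives of [X] vanish, so the curvature kills [X]; it equals K times [rotation],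
    and the nonzero K cancels. *)
Lemma parallel_rotation_invariant r (X : parallel_tensor M r) c x a b I : img c x ->
  slot (rotation (cmetric c x) a b) (X c x) I = 0.
Proof.
move=> Ox.
have := ricci_identity (@img_open _ _ M c) a b I (@msmooth_levi_civita _ _ M c)
  (comp_smooth X c) Ox.
have dd i j : nab (levi_civita c) i (nab (levi_civita c) j (X c)) x I = 0.
  have pX y J : img c y -> nab (levi_civita c) j (X c) y J = (fun _ _ => 0) y J.
    by move=> Oy; apply: (@comp_parallel _ _ _ _ X).
  rewrite (nab_ext (@img_open _ _ M c) _ _ _ Ox pX).
  rewrite /nab cpartial_cst add0r /slot big1 // => s _.
  by rewrite big1 // => l _; rewrite mulr0.
rewrite !dd subrr => /esym E.
have KC : (K%:C : R[i]) != 0.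
  by apply/negP => /eqP/(@complexI R K 0)/eqP; apply/negP.
apply: (mulfI KC); rewrite mulr0 -slotZl -[RHS]E; apply: eq_slot => // k l.
rewrite riemannE (constant_curvature_riemann _ _ _ _ Ox M_curvature) /rotation /cmetric.
by rewrite !(rmorphM, rmorphB, rmorph_nat).
Qed.

Lemma acts_by_scalars0 : acts_by_scalars 0.
Proof.
move=> X; have [a aE] := ptensor0_constant X M_connected.
by exists a => c x [Ox _]; rewrite sum_tuple0 aE.
Qed.

(** The only parallel vector field is 0, since [n - 1] is nonzero; the scalar is therefore 0. *)
Lemma acts_by_scalars1 : acts_by_scalars 1.
Proof.
move=> X; exists 0 => c x [Ox _]; rewrite mul0r big1 // => I _.
have HgE k l : \sum_a ccometric c x k a * cmetric c x a l = (k == l)%:R.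
  rewrite -(rmorph_nat (real_complex R)) -(cometric_metric _ _ Ox) rmorph_sum.
  by apply: eq_bigr => a _; rewrite rmorphM.
have := rotation_invariant1 HgE (fun a b J => parallel_rotation_invariant X a b J Ox) I.
move/eqP; rewrite mulf_eq0 => /predU1P[/eqP|/eqP ->]; last by rewrite mul0r.
by rewrite subr_eq0 -[1]/(1%:R) eqr_nat gtn_eqF.
Qed.

Lemma acts_by_scalars_step r : acts_by_scalars r -> acts_by_scalars r.+2.
Proof.
move=> Qr X.
pose tau (s : 'I_r.+1) : 'S_r.+2 := lift0_perm (tperm ord0 s).
have tauV s : (tau s)^-1%g = tau s by rewrite /tau /lift0_perm lift_permV tpermV.
(* The inverse metric times the contraction of slots 0 and s + 1 of [X]. The scalars [k s] obtained
   below are fixed before any chart or point. *)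
pose Z s := ptensor_tens (ptensor_contr (ptensor_permute (tau s) X)).
have /fin_all_exists[k kE] (s : 'I_r.+1) : exists k : R[i], forall c x, imgU U c x ->
    \sum_I (Z s c x (permute (tau s) I) - X c x (permute (tperm ord0 (lift ord0 s)) I))
      * @iter_nabla _ _ M f c r.+2 x I =
    k * f (Defs.point c x) - \sum_I X c x I * @iter_nabla _ _ M f c r.+2 x I.
  have [k1 E1] := tens_multiple (ptensor_contr (ptensor_permute (tau s) X)) Qr.
  have [k2 E2] := low_multiple (Z s) Qr
    (low_perm_lift_tperm0 U_open f_smooth M_curvature s).
  have [k3 E3] := low_multiple X Qr
    (low_perm_tperm0 U_open f_smooth M_curvature s).
  exists (k1 - k2 + k3) => c x Ox.
  apply: etrans (sum_permute_difference (Z s c x) (X c x)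
    (@iter_nabla _ _ M f c r.+2 x) (tauV s) (tpermV _ _)) _.
  congr (_ - _); rewrite mulrDl mulrBl; congr (_ - _ + _).
  - exact: E1.
  - exact: E2.
  - exact: E3.
(* Solves (n - 1) S = (\sum_s k s) f - (r + 1) S for S. *)
exists ((\sum_s k s) / (n + r)%:R) => c x Ox.
have Ox' : img c x by case: Ox.
have HgE p q : \sum_a ccometric c x p a * cmetric c x a q = (p == q)%:R.
  rewrite -(rmorph_nat (real_complex R)) -(cometric_metric _ _ Ox') rmorph_sum.
  by apply: eq_bigr => a _; rewrite rmorphM.
have inv := rotation_invariant2 HgE (fun a b J => parallel_rotation_invariant X a b J Ox').
set S := \sum_I _.
have E : (n%:R - 1) * S = \sum_s (k s * f (Defs.point c x) - S).
  rewrite /S big_distrr /=; under eq_bigr do rewrite mulrA inv big_distrl.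
  by rewrite exchange_big; apply: eq_bigr => s _; rewrite -kE.
have nr0 : (n + r)%:R != 0 :> R[i].
  by rewrite pnatr_eq0 -lt0n addn_gt0 (leq_trans _ n_ge2).
apply: (mulfI nr0); rewrite mulrA mulrCA mulfV // mulr1.
move: E; rewrite sumrB sumr_const card_ord -big_distrl /= => E.
rewrite -[RHS](subrK (S *+ r.+1)) -E natrD mulrSr -mulr_natl.
by ring.
Qed.

(** The step goes from [r] to [r + 2], so the induction carries two consecutive degrees. *)
Lemma acts_by_scalarsP r : acts_by_scalars r.
Proof.
suff : acts_by_scalars r /\ acts_by_scalars r.+1 by case.
elim: r => [|r [IH IH1]].
  by split; [exact: acts_by_scalars0|exact: acts_by_scalars1].
by split => //; apply: acts_by_scalars_step.
Qed.

Lemma act_hom_scalar r (X : parallel_tensor M r) :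
  exists k : R[i], forall p, U p -> act_hom X f p = k * f p.
Proof.
have [k kE] := acts_by_scalarsP X; exists k => p Up.
have cp : cdom (chart_of (chart_at p)) p by rewrite /chart_at; case: cid.
have pE : Defs.point (chart_at p) (Defs.coord (chart_at p) p) = p by apply: cmapK.
rewrite -[in RHS]pE -kE //; split; first exact: cmap_cimg.
by rewrite pE.
Qed.

End Eigenfunction.

Theorem theorem4p6 (R : realType) (n : nat) (n_ge2 : (2 <= n)%N)
    (M : riemannian_manifold R n)
    (M_connected : connected [set: M])
    (M_complete : geodesically_complete M)
    (K : R) (K_neq0 : K != 0)
    (M_curvature : constant_sectional_curvature M K)
    (U : set M) (U_open : open U) (U_nonempty : U !=set0)
    (f : M -> R[i]) (f_smooth : smooth_fun U f)
    (lam : R[i]) (f_eigen : laplacian_eq U f (fun p => - lam * f p)) :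
  [set h : U -> R[i] | exists X : parallel_ten M,
     h = (fun p : U => act X f (set_val p))] =
  [set h : U -> R[i] | exists a : R[i],
     h = (fun p : U => a * f (set_val p))].
Proof.
apply/seteqP; split => [h [[N X] ->]|h [a ->]] /=.
  have /fin_all_exists[k kE] (r : 'I_N) := act_hom_scalar n_ge2 M_connected K_neq0
    M_curvature U_open f_smooth f_eigen (X r).
  exists (\sum_r k r); apply/funext => p.
  rewrite /act /= big_distrl; apply: eq_bigr => r _.
  by apply: kE; apply: set_valP.
(* The multiple a f is the action of the constant [a], the only component of a family with N = 1.
   The cast is there because an index in ['I_1] equals 0 only propositionally; [eq_axiomK] removes
   it. *)
exists (existT _ 1%N (fun r : 'I_1 =>
  ecast q (parallel_tensor M q) (esym (congr1 (@nat_of_ord 1) (ord1 r))) (ptensor_cst M a))).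
apply/funext => p; rewrite /act /= big_ord1 eq_axiomK /=.
rewrite /act_hom sum_tuple0 /=; congr (_ * f _); apply/esym/cmapK.
by rewrite /chart_at; case: cid.
Qed.
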